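(* The icosahedral POVM $(\pi_y)_{y=1}^{12}$ on $\mathbb{C}^2$ is a $5$-design POVM, its informational power is $$W(\pi_y) = \ln 2 - \frac{5}{12}\ln 5 - \frac{\sqrt5}{12}\ln\frac{9-3\sqrt5}{6},$$ and the supremum defining $W(\pi_y)$ is attained by the anti-icosahedral ensemble $(\psi_x)_{x=1}^{12}$, which satisfies $\psi_x\pi_x = 0$ for every $x$.
   Context: Let $\sigma=(\sigma_1,\sigma_2,\sigma_3)$ be the Pauli matrices, and let $n_1,\dots,n_N$ be the vertices of a regular polyhedron inscribed in the unit sphere of $\mathbb{R}^3$. The associated POVM on $\mathbb{C}^2$ is $\pi_y = \frac1N(\mathbb{1}_2 + n_y\cdot\sigma)$, $y=1,\dots,N$, and the associated anti-ensemble is $\psi_x = \frac{1}{2N}(\mathbb{1}_2 - n_x\cdot\sigma)$, $x=1,\dots,N$. The icosahedral POVM and anti-icosahedral ensemble correspond to the regular icosahedron ($N=12$). A finite POVM $(\pi_y)$ on $\mathbb{C}^d$ (positive semidefinite operators with $\sum_y\pi_y=\mathbb{1}_d$) is a $t$-design POVM if for every integer $1\le k\le t$, $\sum_y \frac{\pi_y^{\otimes k}}{\operatorname{Tr}[\pi_y]^{k-1}} = d\binom{d-1+k}{k}^{-1} P_{\mathrm{sym}}$, where $P_{\mathrm{sym}}$ is the orthogonal projector onto the symmetric subspace of $(\mathbb{C}^d)^{\otimes k}$. An ensemble is a measurable function $x\mapsto\rho_x$ from the reals to positive semidefinite operators of trace at most $1$ with $\int\operatorname{Tr}[\rho_x]\,dx=1$;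 finite ensembles $(\rho_x)$ with $\sum_x\operatorname{Tr}[\rho_x]=1$ are included (sums in place of integrals). With $p_{x,y}=\operatorname{Tr}[\rho_x\pi_y]$ and marginals $p_x,p_y$, the mutual information is $I(\rho_x,\pi_y) := \int\sum_y p_{x,y}\ln\frac{p_{x,y}}{p_xp_y}\,dx$ (with $0\ln0=0$). The informational power is $W(\pi_y) := \sup_{\rho_x} I(\rho_x,\pi_y)$ over all ensembles. *)

(* Defs.v *)
From mathcomp Require Import all_boot all_order all_fingroup all_algebra.
From mathcomp Require Import spectral complex.
From mathcomp Require Import all_classical all_reals all_analysis.

Set Implicit Arguments.
Unset Strict Implicit.
Unset Printing Implicit Defensive.

Import Order.TTheory GRing.Theory Num.Theory.

Local Open Scope classical_set_scope.
Local Open Scope ring_scope.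
Local Open Scope complex_scope.
Local Open Scope sesquilinear_scope.

Section Quantum.
Variable R : realType.

(* For z : R[i], [0 <= z] says that z is real and nonnegative, so Hermitian
   symmetry of A is implied. *)
Definition psd (d : nat) (A : 'M[R[i]]_d) : Prop :=
  forall v : 'cV[R[i]]_d, 0 <= (v^t* *m A *m v) 0 0.

Definition is_povm (d N : nat) (pov : 'I_N -> 'M[R[i]]_d) : Prop :=
  (forall y, psd (pov y)) /\ \sum_y pov y = 1%:M.

(* Operators on (C^d)^{\otimes k} are matrices in the product basis, which is
   indexed, through [tensor_index], by the functions {ffun 'I_k -> 'I_d}. *)
Definition tensor_dim (d k : nat) : nat := #|{ffun 'I_k -> 'I_d}|.

Definition tensor_index (d k : nat) (a : 'I_(tensor_dim d k))
    : {ffun 'I_k -> 'I_d} := enum_val a.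

Definition tensor_power (d k : nat) (A : 'M[R[i]]_d)
    : 'M[R[i]]_(tensor_dim d k) :=
  \matrix_(a, b) \prod_(l < k) A (tensor_index a l) (tensor_index b l).

Definition tensor_perm (d k : nat) (s : 'S_k) : 'M[R[i]]_(tensor_dim d k) :=
  \matrix_(a, b) (tensor_index b == [ffun l => tensor_index a (s l)])%:R.

(* The row space of this matrix is the space of tensors that are fixed by every
   permutation of the k factors. *)
Definition sym_space (d k : nat) : 'M[R[i]]_(tensor_dim d k) :=
  (\bigcap_(s : 'S_k) eigenspace (tensor_perm d s) 1)%MS.

(* [proj_ortho] acts on row vectors; the space is stable under complex
   conjugation, so that its orthogonal projector is a symmetric matrix and the
   row and column conventions agree. *)
Definition proj_sym (d k : nat) : 'M[R[i]]_(tensor_dim d k) :=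
  proj_ortho (sym_space d k).

Definition t_design_povm (t d N : nat) (pov : 'I_N -> 'M[R[i]]_d) : Prop :=
  is_povm pov /\
  forall k : nat, (1 <= k <= t)%N ->
    \sum_y (\tr (pov y) ^+ (k - 1))^-1 *: tensor_power k (pov y) =
    (d%:R / 'C(d - 1 + k, k)%:R) *: proj_sym d k.

(* A trace of a product of positive semidefinite operators is real. *)
Definition rtr (d : nat) (A : 'M[R[i]]_d) : R := complex.Re (\tr A).

(* p ln (p / (q r)), with 0 ln 0 = 0 *)
Definition info_term (p q r : R) : R :=
  if p == 0 then 0 else p * ln (p / (q * r)).

Definition measurable_mx (d : nat) (rho : R -> 'M[R[i]]_d) : Prop :=
  forall i j, measurable_fun setT (fun x => complex.Re (rho x i j)) /\
              measurable_fun setT (fun x => complex.Im (rho x i j)).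

Definition ensemble (d : nat) (rho : R -> 'M[R[i]]_d) : Prop :=
  [/\ measurable_mx rho,
      forall x, psd (rho x),
      forall x, rtr (rho x) <= 1 &
      (\int[@lebesgue_measure R]_x (rtr (rho x))%:E = 1)%E].

Definition mutual_info (d N : nat)
    (rho : R -> 'M[R[i]]_d) (pov : 'I_N -> 'M[R[i]]_d) : \bar R :=
  let p x y := rtr (rho x *m pov y) in
  let px x := \sum_y p x y in
  let py y := \int[@lebesgue_measure R]_x p x y in
  (\int[@lebesgue_measure R]_x (\sum_y info_term (p x y) (px x) (py y))%:E)%E.

Definition finite_ensemble (d M : nat) (rho : 'I_M -> 'M[R[i]]_d) : Prop :=
  (forall x, psd (rho x)) /\ \sum_x rtr (rho x) = 1.

Definition finite_mutual_info (d M N : nat)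
    (rho : 'I_M -> 'M[R[i]]_d) (pov : 'I_N -> 'M[R[i]]_d) : R :=
  let p x y := rtr (rho x *m pov y) in
  let px x := \sum_y p x y in
  let py y := \sum_x p x y in
  \sum_x \sum_y info_term (p x y) (px x) (py y).

Definition informational_power (d N : nat) (pov : 'I_N -> 'M[R[i]]_d)
    : \bar R :=
  ereal_sup
    ([set w | exists rho : R -> 'M[R[i]]_d,
                ensemble rho /\ w = mutual_info rho pov] `|`
     [set w | exists (M : nat) (rho : 'I_M -> 'M[R[i]]_d),
                finite_ensemble rho /\ w = (finite_mutual_info rho pov)%:E]).

Definition pauli (j : 'I_3) : 'M[R[i]]_2 :=
  match val j with
  | 0 => delta_mx 0 1 + delta_mx 1 0
  | 1 => - 'i *: delta_mx 0 1 + 'i *: delta_mx 1 0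
  | _ => delta_mx 0 0 - delta_mx 1 1
  end.

Definition dot_pauli (v : 'rV[R]_3) : 'M[R[i]]_2 :=
  \sum_j (v 0 j)%:C *: pauli j.

Definition bloch_povm (N : nat) (n : 'I_N -> 'rV[R]_3) (y : 'I_N)
    : 'M[R[i]]_2 :=
  N%:R^-1 *: (1%:M + dot_pauli (n y)).

Definition anti_ensemble (N : nat) (n : 'I_N -> 'rV[R]_3) (x : 'I_N)
    : 'M[R[i]]_2 :=
  (2 * N%:R)^-1 *: (1%:M - dot_pauli (n x)).

Definition golden : R := (1 + Num.sqrt 5) / 2.

(* The twelve points (0, +-1, +-golden) and their cyclic permutations, scaled to
   unit length: k is the position of the zero coordinate (k + 1 and k + 2 are
   taken mod 3), b and c are the signs. *)
Definition std_icosahedron (v : 'I_3 * bool * bool) : 'rV[R]_3 :=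
  let: (k, b, c) := v in
  (Num.sqrt (1 + golden ^+ 2))^-1 *:
    \row_j (if j == k then 0
            else if j == k + 1 then (-1) ^+ b
            else (-1) ^+ c * golden).

(* n enumerates, in some order, the vertices of a regular icosahedron inscribed
   in the unit sphere, i.e. of the image of the standard one under some linear
   isometry u |-> u *m Q. *)
Definition icosahedron_vertices (n : 'I_12 -> 'rV[R]_3) : Prop :=
  exists (Q : 'M[R]_3) (f : 'I_12 -> 'I_3 * bool * bool),
    [/\ Q *m Q^T = 1%:M, bijective f &
        forall y, n y = std_icosahedron (f y) *m Q].

End Quantum.

(* Main.v *)
Require Import Defs.
From mathcomp Require Import all_boot all_order all_fingroup all_algebra.
From mathcomp Require Import spectral complex ring lra.
From mathcomp Require Import all_classical all_reals all_analysis.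
From mathcomp Require Import measurable_realfun.

(** Replacing the output distribution [p_y] by the uniform one can only increase
    the mutual information, so it is bounded by the average over the input of
    the relative entropies of [p(y|x)] to the uniform distribution. For a state
    with Bloch vector [u] this relative entropy is the mean over the vertices
    [n_y] of [eta (1 + n_y . u)], where [eta t = t ln t]. Let [p] be the
    polynomial of degree 5 that interpolates [eta] at 0, [1 - 1/sqrt 5]
    (doubly), [1 + 1/sqrt 5] (doubly) and 2; since the sixth derivative of [eta]
    is positive, [eta <= p] between 0 and 2. For a unit [u] the mean of
    [p (1 + n_y . u)] does not depend on [u], because the vertices form a
    spherical 5-design; for [u = - n_x] the numbers [1 + n_y . u] are
    interpolation nodes, so the bound is attained by the anti-icosahedral
    ensemble. *)

Set Implicit Arguments.
Unset Strict Implicit.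
Unset Printing Implicit Defensive.

Import Order.TTheory GRing.Theory Num.Theory.
Import numFieldNormedType.Exports.

Local Open Scope ring_scope.

(** * Hermite interpolation of [t ln t] *)

Section XlnX.
Variable R : realType.
Implicit Types (s t x y z : R) (p : {poly R}).

Definition xlnx t : R := t * ln t.

Lemma xlnx0 : xlnx 0 = 0. Proof. by rewrite /xlnx mul0r. Qed.

Lemma xlnx1 : xlnx 1 = 0. Proof. by rewrite /xlnx ln1 mulr0. Qed.

Lemma ln_le_subr1 x : 0 < x -> ln x <= x - 1.
Proof.
move=> x0; have := @le_ln1Dx R (x - 1).
by rewrite addrCA subrr addr0; apply; rewrite ltrBrDr addNr.
Qed.

Lemma subr1_le_xlnx t : 0 <= t -> t - 1 <= xlnx t.
Proof.
rewrite le_eqVlt => /predU1P[<-|t0]; first by rewrite xlnx0 subr_le0.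
have := @ln_le_subr1 t^-1; rewrite invr_gt0 => /(_ t0).
rewrite lnV ?posrE// -(ler_pM2l t0) mulrBr divff ?gt_eqF// /xlnx; lra.
Qed.

(* Both [1 + z] and [1] lie above the tangent of xlnx at [1 + s z]. *)
Lemma xlnx_convex1 s z : 0 <= s <= 1 -> 0 <= 1 + z ->
  xlnx (1 + s * z) <= s * xlnx (1 + z).
Proof.
move=> /andP[s0 s1] z0; set a := 1 + s * z.
have : 0 <= a by rewrite /a; nra.
(* At [a = 0] the tangent would be vertical; this case forces [s = 1] and [z = -1], where both sides
   are 0. *)
rewrite le_eqVlt => /predU1P[a0|a0].
  have s1' : s = 1 by have := mulr_ge0 s0 z0; rewrite /a in a0; lra.
  have zN : z = -1 by move: a0; rewrite /a s1'; lra.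
  by rewrite -a0 zN subrr xlnx0 mulr0.
have tangent u : 0 <= u -> a * ln a + (ln a + 1) * (u - a) <= xlnx u.
  move=> u0; have := @subr1_le_xlnx (u / a) (divr_ge0 u0 (ltW a0)).
  move: u0; rewrite le_eqVlt => /predU1P[<-|u0 h].
    by rewrite xlnx0 => _; nra.
  move: h; rewrite /xlnx ln_div ?posrE// => /(ler_wpM2l (ltW a0)).
  have e : a * (u / a) = u by rewrite mulrC divfK// gt_eqF.
  by rewrite mulrBr mulr1 (mulrA a (u / a)) e; lra.
have h1 := tangent _ z0; have := tangent 1 ler01; rewrite xlnx1 => h2.
have : (1 - s) * (a * ln a + (ln a + 1) * (1 - a)) <= 0 by nra.
have : s * (a * ln a + (ln a + 1) * (1 + z - a)) <= s * xlnx (1 + z).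
  exact: ler_wpM2l.
rewrite /xlnx {1 4 5 8}/a; have -> : a = 1 + s * z by []; lra.
Qed.

(** With [t = s ^+ 2], [t ln t = 2 s (s ln s)], and [s ln s >= s - 1 >= -1]. This gives the
    continuity of [xlnx] at 0. *)
Lemma xlnx_bound t : 0 < t <= 1 -> `|xlnx t| <= 2 * Num.sqrt t.
Proof.
move=> /andP[t0 t1]; have s0 : 0 < Num.sqrt t by rewrite sqrtr_gt0.
rewrite /xlnx ler0_norm; last by rewrite pmulr_rle0// ln_le0.
rewrite -{1 2}(sqr_sqrtr (ltW t0)) lnXn// -mulr_natl.
have := subr1_le_xlnx (ltW s0); rewrite /xlnx => h.
by rewrite mulr1; have := ler_wpM2l (ltW s0) h; nra.
Qed.

(* On the negative half-line [ln], hence [xlnx], is 0. *)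
Lemma continuous_xlnx : continuous xlnx.
Proof.
move=> x; have [x0|x0|->] := ltgtP x 0.
- have e : xlnx x = 0 by rewrite /xlnx ln0 ?mulr0// ltW.
  rewrite /continuous_at e; apply: cvg_near_cst; near=> y.
  by rewrite /xlnx ln0 ?mulr0// ltW//; near: y; exact: lt_nbhsl.
- by apply: cvgM; [exact: cvg_id|exact: continuous_ln].
- rewrite /continuous_at xlnx0; apply/cvgr0Pnorm_lt => e e0.
  (* Below 1 [xlnx_bound] applies, and below [(e / 2) ^+ 2] its right-hand side is less than [e]. *)
  have m0 : 0 < Num.min 1 ((e / 2) ^+ 2).
    by rewrite lt_min ltr01 exprn_gt0// divr_gt0.
  near=> y.
  have [y0|y0] := leP y 0; first by rewrite /xlnx ln0// mulr0 normr0.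
  have y1 : y < Num.min 1 ((e / 2) ^+ 2).
    by near: y; exact: lt_nbhsl.
  move: y1; rewrite lt_min => /andP[/ltW y1 ye].
  rewrite (le_lt_trans (@xlnx_bound y _)) ?y0//.
  have e20 : 0 < e / 2 by rewrite divr_gt0.
  rewrite mulrC -ltr_pdivlMr// -(gtr0_norm e20) -sqrtr_sqr.
  by rewrite ltr_sqrt// exprn_gt0.
Unshelve. all: by end_near. Qed.

Lemma is_derive_xlnx x : 0 < x -> is_derive x 1 xlnx (ln x + 1).
Proof.
move=> x0; have dln := is_derive1_ln x0.
have := is_deriveM (is_derive_id x 1) dln.
rewrite /= => h; apply: is_derive_eq h _.
by rewrite /GRing.scale/= mulr1 divff ?gt_eqF// addrC.
Qed.

(** Rolle's theorem for [xlnx - p]. The left end may be 0, where [xlnx] is still continuous although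
    not differentiable. *)
Lemma rolle_xlnx p x y : 0 <= x -> x < y ->
    xlnx x = p.[x] -> xlnx y = p.[y] ->
  exists2 c, x < c < y & ln c + 1 = p^`().[c].
Proof.
move=> x0 xy fx fy.
have dF (c : R) : 0 < c ->
    is_derive c 1 (xlnx - horner p : R -> R) (ln c + 1 - p^`().[c]).
  by move=> c0; apply: is_deriveB; exact: is_derive_xlnx.
have [|||c] := @Rolle R (xlnx - horner p : R -> R) x y xy.
- move=> c; rewrite in_itv/= => /andP[xc _].
  by have [] := dF c (le_lt_trans x0 xc).
- apply: continuous_subspaceT => c; apply: continuousB.
    exact: continuous_xlnx.
  exact: continuous_horner.
- by rewrite !fctE fx fy !subrr.
rewrite in_itv/= => cxy [_ dc]; exists c => //.
have [_] := dF c (le_lt_trans x0 (andP cxy).1).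
by rewrite dc => /eqP; rewrite eq_sym subr_eq0 => /eqP.
Qed.

Lemma rolle_ln p x y : 0 < x -> x < y ->
    ln x + 1 = p.[x] -> ln y + 1 = p.[y] ->
  exists2 c, x < c < y & c^-1 = p^`().[c].
Proof.
move=> x0 xy fx fy.
have dF (c : R) : 0 < c ->
    is_derive c 1 ((@ln R) - horner p : R -> R) (c^-1 - p^`().[c]).
  by move=> c0; apply: is_deriveB; exact: is_derive1_ln.
have [|||c] := @Rolle R ((@ln R) - horner p : R -> R) x y xy.
- move=> c; rewrite in_itv/= => /andP[xc _].
  by have [] := dF c (lt_trans x0 xc).
- apply: derivable_within_continuous => c; rewrite in_itv/= => /andP[xc _].
  by have [] := dF c (lt_le_trans x0 xc).
- by rewrite !fctE; lra.
rewrite in_itv/= => cxy [_ dc]; exists c => //.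
have [_] := dF c (lt_trans x0 (andP cxy).1).
by rewrite dc => /eqP; rewrite eq_sym subr_eq0 => /eqP.
Qed.


(** Rolle's theorem in every gap of an increasing list: the zero found in the first gap lies below
    [y], hence below those found in the later gaps. *)
Lemma rolle_ln_path p x (s : seq R) : 0 < x -> path <%R x s ->
    all (fun y => ln y + 1 == p.[y]) (x :: s) ->
  exists c, [/\ size c = size s, path <%R x c &
                all (fun y => y^-1 == p^`().[y]) c].
Proof.
elim: s x => [|y s IHs] x x0; first by exists [::].
move=> /= /andP[xy ys] /and3P[/eqP ex /eqP ey es].
have y0 := lt_trans x0 xy.
have [|c [sc yc ec]] := IHs y y0 ys; first by rewrite /= ey eqxx.
have [d /andP[xd dy] ed] := rolle_ln x0 xy ex ey.
exists (d :: c); rewrite /= sc xd ed eqxx ec; split=> //=.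
case: c yc {sc ec} => //= e c /andP[ye ->].
by rewrite (lt_trans dy ye).
Qed.

(* [hornerE] and [derivE] reassociate products behind [Monoid] projections,
   which [ring] does not see through. *)
Let hE := (hornerD, hornerN, hornerM, hornerZ, hornerX, hornerXsubC, hornerC).
Let dE := (derivXsubC, derivD, derivM, derivZ, derivX).

(* Between the six zeros there are five zeros of [x^-1 - p'(x)], hence the five
   roots of ['X * p^`() - 1], whose value [-1] at 0 is minus its leading
   coefficient [5 * p`_5] times the product of these positive roots. *)
Lemma coef5_gt0_of_six_zeros p x (s : seq R) :
    (size p <= 6)%N -> size s = 5 -> 0 < x -> path <%R x s ->
    all (fun y => ln y + 1 == p.[y]) (x :: s) ->
  0 < p`_5.
Proof.
move=> sp ss x0 xs es.
have [c [sc xc ec]] := rolle_ln_path x0 xs es.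
pose q := 'X * p^`() - 1.
have c_gt0 y : y \in c -> 0 < y.
  move: xc; rewrite lt_path_sortedE => /andP[/allP h _] /h.
  exact: lt_trans.
have uc : uniq c.
  by apply: lt_sorted_uniq; exact: path_sorted xc.
have rc : all (root q) c.
  apply/allP => y yc; rewrite rootE /q !hornerE -(eqP (allP ec _ yc)).
  by rewrite divff ?subrr// gt_eqF ?c_gt0.
have q0 : q.[0] = -1 by rewrite /q !hornerE.
have q5 : q`_5 = 5 * p`_5.
  by rewrite /q coefB coefXM coefC/= subr0 coef_deriv mulr_natl.
have sq : (size q <= 6)%N.
  apply/leq_sizeP => j j6; rewrite /q coefB coefXM coefC.
  rewrite (_ : (j == 0)%N = false); last by case: j j6.
  rewrite coef_deriv subr0 nth_default ?mul0rn// prednK ?(leq_trans sp)//.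
  exact: leq_trans j6.
(* Since [q] is nonzero at 0 and has five distinct roots, its degree is exactly 5. *)
have {}sq : size q = (size c).+1.
  apply/eqP; rewrite eqn_leq {1}sc ss sq /= ltnNge; apply/negP => h.
  have q00 := roots_geq_poly_eq0 rc uc h.
  by move: q0; rewrite q00 horner0 => /eqP; rewrite eq_sym oppr_eq0 oner_eq0.
have := all_roots_prod_XsubC sq rc; rewrite uniq_rootsE uc => /(_ isT) qE.
have lq : lead_coef q = 5 * p`_5 by rewrite lead_coefE sq sc ss.
move: q0; rewrite qE lq.
case: c sc c_gt0 {xc ec uc rc sq qE lq} =>
  [|c1 [|c2 [|c3 [|c4 [|c5 [|]]]]]] //=; rewrite ss//= => _ c_gt0.
have [? ? ? ? ?] : [/\ 0 < c1, 0 < c2, 0 < c3, 0 < c4 & 0 < c5].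
  by split; apply: c_gt0; rewrite !inE eqxx ?orbT.
rewrite unlock /= !hE => h.
have P0 : 0 < 5 * (c1 * (c2 * (c3 * (c4 * c5)))) by rewrite !mulr_gt0.
rewrite -(pmulr_lgt0 _ P0).
suff -> : p`_5 * (5 * (c1 * (c2 * (c3 * (c4 * c5))))) = 1 by [].
by rewrite -[RHS]opprK -h; ring.
Qed.


(** Six conditions for the six coefficients of degree at most 5. The inner nodes are double, so that
    the error need not change sign there; the simple nodes are the ends of [[0, c]]. *)
Definition hermite_xlnx (a b c : R) (p : {poly R}) :=
  [/\ [/\ p.[0] = 0, p.[a] = xlnx a, p.[b] = xlnx b & p.[c] = xlnx c],
      p^`().[a] = ln a + 1 & p^`().[b] = ln b + 1].

(** In the Newton basis for the nodes 0, a, a, b, b, c the conditions form a triangular system,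
    solved one coefficient at a time. *)
Lemma hermite_xlnx_exists (a b c : R) : 0 < a -> a < b -> b < c ->
  exists2 p : {poly R}, (size p <= 6)%N & hermite_xlnx a b c p.
Proof.
move=> a0 ab bc; have b0 := lt_trans a0 ab; have c0 := lt_trans b0 bc.
have nz x : 0 < x -> x != 0 by move=> x0; rewrite gt_eqF.
have solve x y z : x != 0 -> exists k : R, y + k * x = z.
  by move=> x0; exists ((z - y) / x); field.
have [k1 e1] : exists k, 0 + k * a = xlnx a by apply/solve/nz.
have [k2 e2] : exists k, k1 + k * a = ln a + 1 by apply/solve/nz.
have [k3 e3] : exists k,
    (k1 * b + k2 * (b * (b - a))) + k * (b * (b - a) ^+ 2) = xlnx b.
  by apply/solve/nz; rewrite mulr_gt0 ?exprn_gt0 ?subr_gt0.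
have [k4 e4] : exists k, (k1 + k2 * (2 * b - a) +
    k3 * ((b - a) ^+ 2 + 2 * b * (b - a))) + k * (b * (b - a) ^+ 2) = ln b + 1.
  by apply/solve/nz; rewrite mulr_gt0 ?exprn_gt0 ?subr_gt0.
have [k5 e5] : exists k,
    (k1 * c + k2 * (c * (c - a)) + k3 * (c * (c - a) ^+ 2) +
    k4 * (c * (c - a) ^+ 2 * (c - b))) + k * (c * (c - a) ^+ 2 * (c - b) ^+ 2) =
    xlnx c.
  by apply/solve/nz; rewrite !mulr_gt0 ?exprn_gt0 ?subr_gt0// (lt_trans ab bc).
pose m (s : seq R) : {poly R} := \prod_(z <- s) ('X - z%:P).
pose p := k1 *: m [:: 0] + k2 *: m [:: 0; a] + k3 *: m [:: 0; a; a] +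
  k4 *: m [:: 0; a; a; b] + k5 *: m [:: 0; a; a; b; b].
exists p.
  have sm k (s : seq R) : (size s < 6)%N -> (size (k *: m s) <= 6)%N.
    by move=> s6; rewrite (leq_trans (size_scale_leq _ _))// size_prod_XsubC.
  have sD (u v : {poly R}) :
      (size u <= 6 -> size v <= 6 -> size (u + v)%R <= 6)%N.
    by move=> u6 v6; rewrite (leq_trans (size_polyD _ _))// geq_max u6.
  by rewrite /p !sD ?sm.
rewrite /hermite_xlnx /p /m unlock /= !subr0 !mulr1.
split; first split.
- by rewrite !hE; ring.
- by rewrite !hE -e1; ring.
- by rewrite !hE -e3; ring.
- by rewrite !hE -e5; ring.
- by rewrite !dE !hE -e2; ring.
- by rewrite !dE !hE -e4; ring.
Qed.

(** The usual error argument: [K] is chosen so that [q = p + K *: w] interpolates at [t] as well.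
    Counting zeros of the derivative of [xlnx - q] makes its leading coefficient, hence [K],
    positive, while [w] is negative at [t]. *)
Lemma hermite_xlnx_ge (a b c : R) p t : 0 < a -> a < b -> b < c ->
  (size p <= 6)%N -> hermite_xlnx a b c p -> 0 <= t <= c -> xlnx t <= p.[t].
Proof.
move=> a0 ab bc sp [[p0 pa pb pc] p'a p'b] /andP[t0 tc].
have [->|tn0] := eqVneq t 0; first by rewrite p0 xlnx0.
have [->|tna] := eqVneq t a; first by rewrite pa.
have [->|tnb] := eqVneq t b; first by rewrite pb.
have [->|tnc] := eqVneq t c; first by rewrite pc.
have {tn0}t0 : 0 < t by rewrite lt_def tn0.
have {tnc}tc : t < c by rewrite lt_def eq_sym tnc.
pose w : {poly R} := \prod_(z <- [:: 0; a; a; b; b; c]) ('X - z%:P).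
have wE z : w.[z] = z * (z - a) ^+ 2 * (z - b) ^+ 2 * (z - c).
  by rewrite /w unlock /= !hE; ring.
have w'0 z : z \in [:: a; b] -> w^`().[z] = 0.
  rewrite !inE /w unlock /= !subr0 !mulr1 !dE !hE.
  by move=> /orP[/eqP->|/eqP->]; ring.
have wt : w.[t] < 0.
  have sq_gt0 u : t != u -> 0 < (t - u) ^+ 2.
    by move=> tu; rewrite exprn_even_gt0//= subr_eq0.
  by rewrite wE pmulr_rlt0 ?subr_lt0// mulr_gt0 ?sq_gt0// mulr_gt0 ?sq_gt0.
pose K := (xlnx t - p.[t]) / w.[t].
have Kw : K * w.[t] = xlnx t - p.[t] by rewrite divfK// lt_eqF.
pose q := p + K *: w.
have q0 : xlnx 0 = q.[0] by rewrite xlnx0 /q !hornerE p0 wE; ring.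
have qa : xlnx a = q.[a] by rewrite /q !hE pa wE; ring.
have qb : xlnx b = q.[b] by rewrite /q !hE pb wE; ring.
have qc : xlnx c = q.[c] by rewrite /q !hE pc wE; ring.
have qt : xlnx t = q.[t] by rewrite /q !hE Kw; ring.
have q'a : ln a + 1 = q^`().[a].
  by rewrite /q !dE !hE w'0 ?inE ?eqxx// p'a; ring.
have q'b : ln b + 1 = q^`().[b].
  by rewrite /q !dE !hE w'0 ?inE ?eqxx ?orbT// p'b; ring.
have q6 : q`_6 = K.
  rewrite /q coefD coefZ nth_default ?(leq_trans sp)// add0r.
  have := monic_prod_XsubC [:: 0; a; a; b; b; c] predT id.
  by rewrite monicE lead_coefE size_prod_XsubC => /eqP/= ->; rewrite mulr1.
have sq : (size q^`() <= 6)%N.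
  apply/leq_sizeP => j j6; rewrite coef_deriv /q coefD coefZ.
  rewrite nth_default; last exact: leq_trans sp (leqW j6).
  by rewrite nth_default ?size_prod_XsubC// mulr0 addr0 mul0rn.
have K0 : 0 < q^`()`_5.
  have rolle := rolle_xlnx (p := q).
  have b0 := lt_trans a0 ab.
  (* The error [xlnx - q] vanishes at 0, a, b, c and t. Rolle gives four zeros of its derivative,
     and the double nodes a and b make six; the cases only fix their order. *)
  have [ta|at_] := ltP t a.
    have [x1 /andP[? ?] z1] := rolle _ _ (lexx 0) t0 q0 qt.
    have [x2 /andP[? ?] z2] := rolle _ _ (ltW t0) ta qt qa.
    have [x3 /andP[? ?] z3] := rolle _ _ (ltW a0) ab qa qb.
    have [x4 /andP[? ?] z4] := rolle _ _ (ltW b0) bc qb qc.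
    apply: (@coef5_gt0_of_six_zeros _ x1 [:: x2; a; x3; b; x4]) => //=.
      by repeat (apply/andP; split) => //; lra.
    by rewrite z1 z2 z3 z4 q'a q'b !eqxx.
  have {tna}at_ : a < t by rewrite lt_def tna.
  have [x1 /andP[? ?] z1] := rolle _ _ (lexx 0) a0 q0 qa.
  have [tb|bt] := ltP t b.
    have [x2 /andP[? ?] z2] := rolle _ _ (ltW a0) at_ qa qt.
    have [x3 /andP[? ?] z3] := rolle _ _ (ltW t0) tb qt qb.
    have [x4 /andP[? ?] z4] := rolle _ _ (ltW b0) bc qb qc.
    apply: (@coef5_gt0_of_six_zeros _ x1 [:: a; x2; x3; b; x4]) => //=.
      by repeat (apply/andP; split) => //; lra.
    by rewrite z1 z2 z3 z4 q'a q'b !eqxx.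
  have {tnb}bt : b < t by rewrite lt_def tnb.
  have [x2 /andP[? ?] z2] := rolle _ _ (ltW a0) ab qa qb.
  have [x3 /andP[? ?] z3] := rolle _ _ (ltW b0) bt qb qt.
  have [x4 /andP[? ?] z4] := rolle _ _ (ltW t0) tc qt qc.
  apply: (@coef5_gt0_of_six_zeros _ x1 [:: a; x2; b; x3; x4]) => //=.
    by repeat (apply/andP; split) => //; lra.
  by rewrite z1 z2 z3 z4 q'a q'b !eqxx.
move: K0; rewrite coef_deriv q6 pmulrn_lgt0// => K0.
by have := nmulr_llt0 K wt; rewrite Kw K0 subr_lt0 => /ltW.
Qed.

End XlnX.

(** * Moments of the icosahedron *)

Lemma ord2P (i : 'I_2) : i = 0 \/ i = 1.
Proof. by case: i => [[|[|]]] // i2; [left|right]; exact: val_inj. Qed.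

Lemma ord3P (i : 'I_3) : [\/ i = 0, i = 1 | i = 2%:R].
Proof.
by case: i => [[|[|[|]]]] // i3; [apply: Or31|apply: Or32|apply: Or33];
  exact: val_inj.
Qed.

Lemma sum_ord2 (V : nmodType) (F : 'I_2 -> V) : \sum_i F i = F 0 + F 1.
Proof.
by rewrite !big_ord_recl big_ord0 addr0; congr (F _ + F _); exact: val_inj.
Qed.

Lemma sum_ord3 (V : nmodType) (F : 'I_3 -> V) :
  \sum_i F i = F 0 + F 1 + F 2%:R.
Proof.
rewrite !big_ord_recl big_ord0 addr0 addrA.
by congr (F _ + F _ + F _); exact: val_inj.
Qed.

Section Icosahedron.
Variable R : realType.

Local Notation vtx := ('I_3 * bool * bool)%type.
Local Notation g := (golden R).

Lemma golden_sqr : g ^+ 2 = g + 1.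
Proof.
have h5 : Num.sqrt 5 ^+ 2 = 5 :> R by rewrite sqr_sqrtr.
have -> : g ^+ 2 = (1 + 2 * Num.sqrt 5 + Num.sqrt 5 ^+ 2) / 4.
  by rewrite /golden; field.
by rewrite h5 /golden; field.
Qed.

Local Notation s := ((Num.sqrt (1 + g ^+ 2))^-1).

Lemma scale_sqr : s ^+ 2 * (1 + g ^+ 2) = 1.
Proof.
have p : 0 < 1 + g ^+ 2 by rewrite ltr_wpDr// sqr_ge0.
by rewrite exprVn sqr_sqrtr ?ltW// mulVf// gt_eqF.
Qed.

(* Besides real vectors [u], complex ones are needed: they give access to the
   entries of the tensor powers of the effects. *)
Section Moments.
Variables (A : comNzRingType) (h : {rmorphism R -> A}).

Definition dotv (v : 'rV[R]_3) (u : 'cV[A]_3) : A := (map_mx h v *m u) 0 0.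

(** Free of complex conjugation, so that the moment identities stay polynomial in [u]. *)
Definition sqnorm (u : 'cV[A]_3) : A := (u^T *m u) 0 0.

(** Twelve times the mean of the e-th power of a coordinate over the unit sphere. *)
Definition moment (e : nat) : R := if odd e then 0 else 12 / e.+1%:R.

Lemma dotvE v u : dotv v u =
  h (v 0 0) * u 0 0 + h (v 0 1) * u 1 0 + h (v 0 2%:R) * u 2%:R 0.
Proof.
by rewrite /dotv mxE sum_ord3 !mxE.
Qed.

Lemma sqnormE u : sqnorm u = u 0 0 ^+ 2 + u 1 0 ^+ 2 + u 2%:R 0 ^+ 2.
Proof.
by rewrite /sqnorm mxE sum_ord3 !mxE -!expr2.
Qed.

Lemma dotv_std0 b c u : dotv (std_icosahedron R (0, b, c)) u =
  h s * ((-1) ^+ b * u 1 0 + (-1) ^+ c * (h g * u 2%:R 0)).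
Proof. by rewrite dotvE !mxE /= mulr0 rmorph0 !rmorphM !rmorph_sign; ring. Qed.

Lemma dotv_std1 b c u : dotv (std_icosahedron R (1, b, c)) u =
  h s * ((-1) ^+ b * u 2%:R 0 + (-1) ^+ c * (h g * u 0 0)).
Proof. by rewrite dotvE !mxE /= mulr0 rmorph0 !rmorphM !rmorph_sign; ring. Qed.

Lemma dotv_std2 b c u : dotv (std_icosahedron R (2%:R, b, c)) u =
  h s * ((-1) ^+ b * u 0 0 + (-1) ^+ c * (h g * u 1 0)).
Proof. by rewrite dotvE !mxE /= mulr0 rmorph0 !rmorphM !rmorph_sign; ring. Qed.

Lemma sum_vtx (F : vtx -> A) : \sum_v F v =
  \sum_(b : bool) \sum_(c : bool) (F (0, b, c) + F (1, b, c) + F (2%:R, b, c)).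
Proof.
rewrite (eq_bigr (fun v => F (v.1.1, v.1.2, v.2))); last by case=> [[]].
rewrite -(pair_bigA _ (fun p c => F (p.1, p.2, c))) /=.
rewrite -(pair_bigA _ (fun k b => \sum_c F (k, b, c))) /=.
rewrite exchange_big; apply: eq_bigr => b _; rewrite exchange_big.
by apply: eq_bigr => c _; rewrite sum_ord3.
Qed.

(** Sign changes of the coordinates cancel the odd powers. In degree 4 the deviation from a multiple
    of [sqnorm u ^+ 2] is a multiple of [x ^+ 4 + y ^+ 4 + z ^+ 4], whose coefficient vanishes
    because [1 + g ^+ 4 = 3 * g ^+ 2]. *)
Lemma std_moment u e : (e <= 5)%N ->
  \sum_v dotv (std_icosahedron R v) u ^+ e = h (moment e) * sqnorm u ^+ e./2.
Proof.
have hg : h g ^+ 2 = h g + 1 by rewrite -rmorphXn golden_sqr rmorphD rmorph1.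
have hs : h s ^+ 2 * (1 + h g ^+ 2) = 1.
  by rewrite -!rmorphXn -(rmorph1 h) -rmorphD -rmorphM scale_sqr.
have h5 : h (12 / 5) = 12 * (h s ^+ 4 * h g ^+ 2).
  (* Both sides equal [5 * g + 5]; this is what turns [s ^+ 4 * g ^+ 2] into [1 / 5]. *)
  have g5 : 5 * g ^+ 2 = (1 + g ^+ 2) ^+ 2.
    by rewrite golden_sqr; ring: golden_sqr.
  have -> : 12 / 5 = 12 * (s ^+ 4 * g ^+ 2) :> R.
    have : 5 * (s ^+ 4 * g ^+ 2) = 1.
      by rewrite mulrCA g5 (exprM _ 2 2) -exprMn scale_sqr expr1n.
    lra.
  by rewrite rmorphM rmorph_nat rmorphM !rmorphXn.
rewrite sum_vtx !big_bool !(dotv_std0, dotv_std1, dotv_std2) !expr0 !expr1.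
rewrite sqnormE.
move: (u 0 0) (u 1 0) (u 2%:R 0) => x y z.
case: e => [|[|[|[|[|[|]]]]]] //= _; rewrite /moment /=.
- by rewrite !expr0 divr1 rmorph_nat; ring.
- by rewrite rmorph0; ring.
- have -> : 12 / 3 = 4 :> R by field.
  rewrite rmorph_nat expr1; set s' := h _ in hs *; set g' := h _ in hs *.
  transitivity (4 * (s' ^+ 2 * (1 + g' ^+ 2)) * (x ^+ 2 + y ^+ 2 + z ^+ 2)).
    by ring.
  by rewrite hs mulr1.
- by rewrite rmorph0; ring.
- rewrite h5.
  have h4 : 1 + h g ^+ 4 = 3 * h g ^+ 2.
    by rewrite (exprM _ 2 2) hg; ring: hg.
  set s' := h _; set g' := h _ in h4 *.
  transitivity (12 * (s' ^+ 4 * g' ^+ 2) * (x ^+ 2 + y ^+ 2 + z ^+ 2) ^+ 2 +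
    4 * s' ^+ 4 * (1 + g' ^+ 4 - 3 * g' ^+ 2) * (x ^+ 4 + y ^+ 4 + z ^+ 4)).
    by ring.
  by rewrite h4 subrr; ring.
- by rewrite rmorph0; ring.
Qed.
End Moments.

Section Vertices.
Variables (n : 'I_12 -> 'rV[R]_3) (hn : icosahedron_vertices n).

(** The isometry [Q] is moved from the vertices to [u]; being orthogonal, it preserves [sqnorm] over
    any [A]. *)
Lemma icosahedron_moment (A : comNzRingType) (h : {rmorphism R -> A})
    (u : 'cV[A]_3) e : (e <= 5)%N ->
  \sum_y dotv h (n y) u ^+ e = h (moment e) * sqnorm u ^+ e./2.
Proof.
case: hn => Q [f [QQ bf nE]] e5.
have -> : sqnorm u = sqnorm (map_mx h Q *m u).
  rewrite /sqnorm trmx_mul mulmxA -(mulmxA u^T) map_trmx -map_mxM.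
  by rewrite (mulmx1C QQ) map_mx1 mulmx1.
rewrite -(std_moment h _ e5) (reindex f) /=; last exact: onW_bij.
by apply: eq_bigr => y _; rewrite /dotv nE map_mxM mulmxA.
Qed.

(** For vertices with the same zero coordinate the product is, up to sign,
    [s ^+ 2 * (1 + g ^+ 2) = 1] or [s ^+ 2 * (1 - g ^+ 2)]; otherwise it is [s ^+ 2 * g] up to sign.
    The last two both have square [1 / 5]. *)
Lemma dotv_vertices x y : let t := dotv idfun (n x) (n y)^T in
  t = 1 \/ t = -1 \/ t ^+ 2 = 1 / 5.
Proof.
case: hn => Q [f [QQ bf nE]] /=.
have -> : dotv idfun (n x) (n y)^T =
  dotv idfun (std_icosahedron R (f x)) (std_icosahedron R (f y))^T.
  rewrite /dotv !nE !map_mx_id // trmx_mul mulmxA -(mulmxA _ Q) QQ mulmx1 //.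
have g5 : 5 * g ^+ 2 = (1 + g ^+ 2) ^+ 2.
  by rewrite golden_sqr; ring: golden_sqr.
have ss := scale_sqr.
have sg : (s ^+ 2 * g) ^+ 2 = 1 / 5.
  have : 5 * (s ^+ 4 * g ^+ 2) = 1.
    by rewrite mulrCA g5 (exprM _ 2 2) -exprMn scale_sqr expr1n.
  have -> : (s ^+ 2 * g) ^+ 2 = s ^+ 4 * g ^+ 2 by ring.
  lra.
have diag (b c b' c' : bool) (t : R) :
    t = s ^+ 2 * ((-1) ^+ b * (-1) ^+ b' + (-1) ^+ c * (-1) ^+ c' * g ^+ 2) ->
    t = 1 \/ t = -1 \/ t ^+ 2 = 1 / 5.
  have sg' : (s ^+ 2 * (1 - g ^+ 2)) ^+ 2 = 1 / 5.
    by rewrite -sg golden_sqr; ring.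
  have sgn (u : bool) : (-1) ^+ u = 1 :> R \/ (-1) ^+ u = -1 :> R.
    by case: u; [right|left]; rewrite ?expr1 ?expr0.
  move=> ->; rewrite -!signr_addb.
  case: (sgn (b (+) b')) => ->; case: (sgn (c (+) c')) => ->.
  - by left; rewrite mul1r.
  - by right; right; rewrite mulN1r.
  - by right; right; rewrite -sg'; ring.
  - by right; left; rewrite mulN1r -opprD mulrN ss.
have off (b c : bool) (t : R) : t = (-1) ^+ b * (-1) ^+ c * (s ^+ 2 * g) ->
    t = 1 \/ t = -1 \/ t ^+ 2 = 1 / 5.
  by move=> ->; right; right; rewrite exprMn sg exprMn !sqrr_sign !mul1r.
case: (f x) => [[i b] c]; case: (f y) => [[j b'] c'].
case: (ord3P i) => ->; case: (ord3P j) => ->;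
  rewrite (dotv_std0, dotv_std1, dotv_std2) !mxE /=.
- by apply: (diag b c b' c'); ring.
- by apply: (off c b'); ring.
- by apply: (off b c'); ring.
- by apply: (off b c'); ring.
- by apply: (diag b c b' c'); ring.
- by apply: (off c b'); ring.
- by apply: (off c b'); ring.
- by apply: (off b c'); ring.
- by apply: (diag b c b' c'); ring.
Qed.

Lemma dotv_self x : dotv idfun (n x) (n x)^T = 1.
Proof.
case: hn => Q [f [QQ bf nE]] /=.
have -> : dotv idfun (n x) (n x)^T =
  dotv idfun (std_icosahedron R (f x)) (std_icosahedron R (f x))^T.
  by rewrite /dotv !nE !map_mx_id // trmx_mul mulmxA -(mulmxA _ Q) QQ mulmx1.
have d (b c : bool) (t : R) :
    t = s ^+ 2 * ((-1) ^+ b ^+ 2 + (-1) ^+ c ^+ 2 * g ^+ 2) -> t = 1.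
  by rewrite !sqrr_sign mul1r scale_sqr.
case: (f x) => [[i b] c].
by case: (ord3P i) => ->; rewrite (dotv_std0, dotv_std1, dotv_std2) !mxE /=;
  apply: (d b c); ring.
Qed.

End Vertices.
End Icosahedron.

(** * The design property *)

Section Bivariate.
Variable F : numFieldType.

Lemma poly_fun_eq0 (p : {poly F}) : (forall x, p.[x] = 0) -> p = 0.
Proof.
move=> p0; apply: (@roots_geq_poly_eq0 _ _ [seq i%:R | i <- iota 0 (size p)]).
- by apply/allP => x _; rewrite rootE p0.
- by rewrite map_inj_uniq ?iota_uniq// => i j /eqP; rewrite eqr_nat => /eqP.
- by rewrite size_map size_iota.
Qed.

(** Coefficients are compared in one variable at a time. It serves to read sums over the vertices
    off a generating function. *)
Lemma bivariate_eq0 m (K : 'I_m -> 'I_m -> F) :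
  (forall x y, \sum_i \sum_j K i j * x ^+ i * y ^+ j = 0) ->
  forall i j, K i j = 0.
Proof.
have coef (L : 'I_m -> F) :
    (forall x, \sum_i L i * x ^+ i = 0) -> forall i, L i = 0.
  move=> L0 i; pose p := \sum_i L i *: 'X^i.
  have p0 : p = 0.
    apply: poly_fun_eq0 => x; rewrite -(L0 x) horner_sum.
    by apply: eq_bigr => j _; rewrite !hornerE.
  have := congr1 (fun q : {poly F} => q`_i) p0; rewrite coef0 => <-.
  rewrite coef_sum (bigD1 i)//= coefZ coefXn eqxx mulr1 big1 ?addr0// => j ji.
  by rewrite coefZ coefXn eq_sym (inj_eq val_inj) (negbTE ji) mulr0.
move=> K0 i j; apply: (coef (K i)) => y {j}.
apply: (coef (fun i => \sum_j K i j * y ^+ j)) => x {i}; rewrite -[RHS](K0 x y).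
apply: eq_bigr => i _; rewrite mulr_suml; apply: eq_bigr => j _.
by rewrite mulrAC.
Qed.

(** The determinant vanishes, so a nonzero first row spans the row space; if the first row is zero,
    the second one does. *)
Lemma rank_one_factor (B : 'M[F]_2) : B 0 0 * B 1 1 = B 0 1 * B 1 0 ->
  exists p q : 'I_2 -> F, forall i j, B i j = p i * q j.
Proof.
move=> dB.
have all2 (P : 'I_2 -> 'I_2 -> Prop) :
    P 0 0 -> P 0 1 -> P 1 0 -> P 1 1 -> forall i j, P i j.
  by move=> P00 P01 P10 P11 i j; case: (ord2P i) => ->; case: (ord2P j) => ->.
have [B00|B00] := eqVneq (B 0 0) 0; last first.
  exists (fun i => B i 0 / B 0 0), (fun j => B 0 j); apply: all2.
  - by rewrite divfK.
  - by rewrite divff// mul1r.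
  - by rewrite divfK.
  - by apply: (mulfI B00); rewrite dB; field.
have [B01|B01] := eqVneq (B 0 1) 0; last first.
  exists (fun i => B i 1 / B 0 1), (fun j => B 0 j).
  have B10 : B 1 0 = 0 by apply: (mulfI B01); rewrite -dB B00 mul0r mulr0.
  apply: all2.
  - by rewrite divff// mul1r.
  - by rewrite divfK.
  - by rewrite B00 B10 mulr0.
  - by rewrite divfK.
exists (fun i => (i == 1)%:R), (fun j => B 1 j).
by apply: all2; rewrite /= ?B00 ?B01 ?mul0r ?mul1r.
Qed.

End Bivariate.

(** * Weights of the basis indices of a tensor power of the qubit *)

Section Weight.

Definition wt k (a : {ffun 'I_k -> 'I_2}) : nat := #|[set i | a i == 1]|.

Lemma wt_le k (a : {ffun 'I_k -> 'I_2}) : (wt a <= k)%N.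
Proof. by rewrite -[leqRHS]card_ord max_card. Qed.

Lemma prod_wt (A : comNzRingType) k (a : {ffun 'I_k -> 'I_2}) (p : 'I_2 -> A) :
  \prod_l p (a l) = p 0 ^+ (k - wt a) * p 1 ^+ wt a.
Proof.
rewrite (bigID (fun l => a l == 1)) /= mulrC; congr (_ * _).
  rewrite (eq_bigr (fun=> p 0)); last first.
    by move=> l; case: (a l) => [[|[|]]] // i2 _; congr p; apply: val_inj.
  rewrite prodr_const; congr (_ ^+ _).
  have -> : (k - wt a)%N = #|~: [set i | a i == 1]|.
    by rewrite [RHS]cardsCs finset.setCK card_ord.
  by apply: eq_card => l; rewrite !inE.
rewrite (eq_bigr (fun=> p 1)) => [|l /eqP-> //].
by rewrite prodr_const; congr (_ ^+ _); apply: eq_card => l; rewrite !inE.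
Qed.

(** Equal weights mean equal multiplicities of both values, so the weight classes are single orbits
    of the permutations of the factors. *)
Lemma wt_eq_perm k (a b : {ffun 'I_k -> 'I_2}) : wt a = wt b ->
  exists s : 'S_k, b = [ffun l => a (s l)].
Proof.
move=> ab.
have cnt (c : {ffun 'I_k -> 'I_2}) : count_mem 1 [tuple c i | i < k] = wt c.
  rewrite count_map /wt cardE /enum_mem size_filter /= enumT.
  by apply: eq_count => i /=; rewrite inE.
have /tuple_permP[s sE] : perm_eq [tuple b i | i < k] [tuple a i | i < k].
  apply/allP => x _ /=; apply/eqP.
  have [->|x1] := eqVneq x 1; first by rewrite !cnt.
  have c0 (c : {ffun 'I_k -> 'I_2}) :
      count_mem x [tuple c i | i < k] = (k - wt c)%N.
    have := count_predC (pred1 1) [tuple c i | i < k].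
    rewrite size_tuple cnt => e; apply: (@addnI (wt c)).
    rewrite subnKC ?wt_le// -[RHS]e; congr addn.
    apply: eq_count => y /=; case: x x1 => [[|[|]]] //; case: y => [[|[|]]] //.
  by rewrite !c0 ab.
exists s; apply/ffunP => l; rewrite ffunE.
by have := congr1 (fun t => tnth t l) (val_inj sE); rewrite !tnth_mktuple.
Qed.

Lemma card_wt k j : #|[set a : {ffun 'I_k -> 'I_2} | wt a == j]| = 'C(k, j).
Proof.
rewrite -[k in RHS]card_ord -card_draws.
pose f (a : {ffun 'I_k -> 'I_2}) : {set 'I_k} := [set i | a i == 1].
have finj : injective f.
  move=> a b /setP ab; apply/ffunP => i; have := ab i; rewrite !inE.
  case: (a i) => [[|[|]]] //; case: (b i) => [[|[|]]] // ? ? _; exact: val_inj.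
rewrite -(card_imset _ finj); apply: eq_card => A; rewrite !inE.
apply/imsetP/idP => [[a]|/eqP Aj]; first by rewrite inE /wt => aj ->.
exists [ffun i => (i \in A)%:R].
  rewrite inE /wt -Aj; apply/eqP/eq_card => i; rewrite !inE ffunE.
  by case: (i \in A).
by apply/setP => i; rewrite !inE ffunE; case: (i \in A).
Qed.

End Weight.

(** * The projector onto the symmetric subspace *)

Section SymProj.
Local Open Scope complex_scope.
Local Open Scope sesquilinear_scope.
Variables (R : realType) (k : nat).
Local Notation C := R[i].
Local Notation D := (tensor_dim 2 k).

Let ti : 'I_D -> {ffun 'I_k -> 'I_2} := @tensor_index 2 k.

Let ti_bij : bijective ti.
Proof. exact: enum_val_bij. Qed.

(** Averaging over each weight class; the class of weight [j] has ['C(k, j)] elements. *)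
Definition wt_mx : 'M[C]_D :=
  \matrix_(a, b) ((wt (ti a) == wt (ti b))%:R / 'C(k, wt (ti a))%:R).

Lemma wt_perm (a : {ffun 'I_k -> 'I_2}) (s : 'S_k) :
  wt [ffun l => a (s l)] = wt a.
Proof.
rewrite /wt -(card_imset _ (@perm_inj _ s)); apply: eq_card => l.
apply/imsetP/idP => [[m]|]; first by rewrite !inE ffunE => am ->.
rewrite inE => al; exists ((s^-1)%g l); last by rewrite permKV.
by rewrite inE ffunE permKV.
Qed.

Lemma mul_tensor_perm m (A : 'M[C]_(m, D)) (s : 'S_k) i a b :
    ti b = [ffun l => ti a (s l)] -> (A *m tensor_perm R 2 s) i b = A i a.
Proof.
move=> ab; rewrite mxE (bigD1 a)//= mxE -/ti ab eqxx mulr1.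
rewrite big1 ?addr0// => c ca.
rewrite mxE -/ti ab.
case: eqP => [/ffunP h|]; last by rewrite mulr0.
case/eqP: ca; apply: (bij_inj ti_bij); apply/ffunP => l.
by have := h ((s^-1)%g l); rewrite !ffunE permKV => <-.
Qed.

(** A tensor fixed by all permutations is constant on their orbits of basis indices, which are the
    weight classes. *)
Lemma sym_spaceP m (A : 'M[C]_(m, D)) :
  reflect (forall i a b, wt (ti a) = wt (ti b) -> A i a = A i b)
          (A <= sym_space R 2 k)%MS.
Proof.
apply: (iffP idP) => [/sub_bigcapmxP As i a b ab|As].
  have [s bE] := wt_eq_perm ab.
  have /eigenspaceP := As s isT; rewrite scale1r => E.
  by rewrite -[in RHS]E (mul_tensor_perm _ _ bE).
apply/sub_bigcapmxP => s _; apply/eigenspaceP; rewrite scale1r.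
apply/matrixP => i b; case: ti_bij => t' tK Kt.
pose a := t' [ffun l => ti b ((s^-1)%g l)].
have ab : ti b = [ffun l => ti a (s l)].
  by apply/ffunP => l; rewrite /a Kt !ffunE permK.
by rewrite (mul_tensor_perm _ _ ab); apply: As; rewrite ab wt_perm.
Qed.

Lemma mul_wt_mx m (A : 'M[C]_(m, D)) : (A <= sym_space R 2 k)%MS ->
  A *m wt_mx = A.
Proof.
move=> /sym_spaceP As; apply/matrixP => i b; rewrite mxE.
rewrite (bigID (fun a => wt (ti a) == wt (ti b))) /=.
rewrite [X in _ + X]big1 ?addr0; last first.
  by move=> a /negbTE ab; rewrite mxE ab mul0r mulr0.
rewrite (eq_bigr (fun=> A i b / 'C(k, wt (ti b))%:R)); last first.
  by move=> a /eqP ab; rewrite mxE ab eqxx mul1r (As i a b ab).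
rewrite sumr_const -[_ *+ #|_|]mulr_natr -mulrA; set c := #|_|.
have -> : c = 'C(k, wt (ti b)).
  rewrite -card_wt /c -(card_imset _ (bij_inj ti_bij)).
  case: ti_bij => t' tK Kt; apply: eq_card => a; rewrite inE.
  apply/imsetP/idP => [[x xb ->]//|ab]; exists (t' a) => //.
  by rewrite unfold_in /= Kt.
by rewrite mulVf ?mulr1// pnatr_eq0 -lt0n bin_gt0 wt_le.
Qed.

Lemma wt_mx_tr : wt_mx^t* = wt_mx.
Proof.
apply/matrixP => a b; rewrite !mxE eq_sym.
rewrite fmorph_div !rmorph_nat.
by case: eqP => [->|]; rewrite ?mul0r.
Qed.

(** The rows of [wt_mx] are symmetric, and those of [1%:M - wt_mx] are orthogonal to the symmetric
    space, because [wt_mx] is Hermitian and fixes that space. *)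
Lemma proj_symE : proj_sym R 2 k = wt_mx.
Proof.
have GP : wt_mx *m proj_sym R 2 k = wt_mx.
  apply: proj_ortho_id; apply/sym_spaceP => i a b ab.
  by rewrite !mxE ab.
have : (1%:M - wt_mx) *m proj_sym R 2 k = 0.
  apply: proj_ortho_0; apply/orthomx1P.
  have U := mul_wt_mx (submx_refl (sym_space R 2 k)).
  rewrite mulmxBl mul1mx -[X in _ - X *m _]wt_mx_tr -map_mxM -trmx_mul U.
  exact: subrr.
by rewrite mulmxBl mul1mx GP => /eqP; rewrite subr_eq0 => /eqP.
Qed.

End SymProj.

(** * Bloch matrices and the design identity *)

Section Design.
Local Open Scope complex_scope.
Variable R : realType.
Local Notation C := R[i].
Local Notation h := (real_complex R : {rmorphism R -> C}).

Lemma dot_pauliE (v : 'rV[R]_3) :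
  [/\ dot_pauli v 0 0 = (v 0 2%:R)%:C,
      dot_pauli v 0 1 = (v 0 0)%:C - 'i * (v 0 1)%:C,
      dot_pauli v 1 0 = (v 0 0)%:C + 'i * (v 0 1)%:C &
      dot_pauli v 1 1 = - (v 0 2%:R)%:C].
Proof.
have -> : dot_pauli v = (v 0 0)%:C *: pauli R 0 + (v 0 1)%:C *: pauli R 1 +
    (v 0 2%:R)%:C *: pauli R 2%:R.
  by rewrite /dot_pauli sum_ord3.
by rewrite /pauli /=; split; rewrite !mxE /=; ring.
Qed.

Definition bloch_mx (v : 'rV[R]_3) : 'M[C]_2 := 1%:M + dot_pauli v.

Lemma bloch_mxE (v : 'rV[R]_3) :
  [/\ bloch_mx v 0 0 = 1 + (v 0 2%:R)%:C,
      bloch_mx v 0 1 = (v 0 0)%:C - 'i * (v 0 1)%:C,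
      bloch_mx v 1 0 = (v 0 0)%:C + 'i * (v 0 1)%:C &
      bloch_mx v 1 1 = 1 - (v 0 2%:R)%:C].
Proof.
case: (dot_pauliE v) => e00 e01 e10 e11.
by rewrite /bloch_mx; split; rewrite mxE ?(e00, e01, e10, e11) mxE /= ?add0r.
Qed.

Lemma i_sqr : 'i * 'i = -1 :> C.
Proof. by rewrite -expr2 sqr_i. Qed.

(** The determinant of [bloch_mx v] is 1 minus the squared length of [v]. *)
Lemma bloch_mx_rank1 (v : 'rV[R]_3) : dotv idfun v v^T = 1 ->
  exists p q : 'I_2 -> C, forall i j, bloch_mx v i j = p i * q j.
Proof.
rewrite dotvE !mxE /= => v1; apply: rank_one_factor.
case: (bloch_mxE v) => -> -> -> ->.
have {}v1 : 1 = (v 0 0)%:C * (v 0 0)%:C + (v 0 1)%:C * (v 0 1)%:C +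
    (v 0 2%:R)%:C * (v 0 2%:R)%:C.
  by rewrite -!rmorphM -!rmorphD v1.
transitivity (1 - (v 0 2%:R)%:C ^+ 2); first by ring.
rewrite [in LHS]v1.
transitivity ((v 0 0)%:C ^+ 2 + (v 0 1)%:C ^+ 2); first by ring.
by rewrite mulrDr !mulrBl; ring: i_sqr.
Qed.

(** Both sides are twelve times the mean of [(1 + z) ^+ k] for [z] uniform on [[-1, 1]], the law of
    a coordinate on the sphere. *)
Lemma sum_moment_bin k : (k <= 5)%N ->
  \sum_(e < k.+1) moment R e *+ 'C(k, e) = 12 * 2 ^+ k / k.+1%:R.
Proof.
move=> k5; rewrite -(big_mkord xpredT (fun e => moment R e *+ 'C(k, e))).
case: k k5 => [|[|[|[|[|[|]]]]]] //= _; rewrite unlock /= /moment /=;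
  rewrite ?mul0rn ?bin0 ?bin2 ?binn ?(binSn 4) /=; by field.
Qed.

Variables (n : 'I_12 -> 'rV[R]_3) (hn : icosahedron_vertices n).

Local Notation form v x y :=
  (\sum_(i < 2) \sum_(j < 2) x ^+ i * y ^+ j * bloch_mx v i j).

(* The quadratic form is [1 + x y + n . u] for a complex [u] whose square is
   [(1 + x y) ^+ 2]. *)
Lemma bloch_form_moment (x y : C) k : (k <= 5)%N ->
  \sum_l form (n l) x y ^+ k =
    (12 * 2 ^+ k / k.+1%:R) * (1 + x * y) ^+ k.
Proof.
move=> k5; pose u : 'cV[C]_3 :=
  \col_i (if i == 0 then x + y else if i == 1 then 'i * (x - y) else 1 - x * y).
have uE : [/\ u 0 0 = x + y, u 1 0 = 'i * (x - y) & u 2%:R 0 = 1 - x * y].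
  by rewrite !mxE.
have formE l : form (n l) x y = (1 + x * y) + dotv h (n l) u.
  rewrite !sum_ord2 dotvE.
  case: uE => -> -> ->.
  case: (bloch_mxE (n l)) => -> -> -> -> /=; rewrite !expr1 !expr0.
  by ring: i_sqr.
have uu : sqnorm u = (1 + x * y) ^+ 2.
  by rewrite sqnormE; case: uE => -> -> ->; rewrite exprMn sqr_i; ring.
have expand l : form (n l) x y ^+ k =
  \sum_(e < k.+1) (1 + x * y) ^+ (k - e) * dotv h (n l) u ^+ e *+ 'C(k, e).
  by rewrite formE exprDn.
rewrite (eq_bigr _ (fun l _ => expand l)) exchange_big /=.
have step (e : 'I_k.+1) :
   \sum_l ((1 + x * y) ^+ (k - e) * dotv h (n l) u ^+ e) *+ 'C(k, e) =
   h (moment R e) *+ 'C(k, e) * (1 + x * y) ^+ k.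
  rewrite sumrMnl -mulr_sumr icosahedron_moment//; last first.
    by rewrite (leq_trans _ k5)// -ltnS.
  rewrite uu -exprM mulrCA /moment; case: ifP => oe.
    by rewrite rmorph0 !mul0r mul0rn mul0r.
  have e2 : (2 * e./2 = e)%N by rewrite mul2n even_halfK ?oe.
  rewrite e2; move: (h _) (1 + x * y) => K z.
  by rewrite -exprD subnK -1?ltnS// mulrnAl.
rewrite (eq_bigr _ (fun e _ => step e)) -mulr_suml; congr (_ * _).
transitivity (h (\sum_(e < k.+1) moment R e *+ 'C(k, e))).
  by rewrite rmorph_sum; apply: eq_bigr => e _; rewrite rmorphMn.
by rewrite sum_moment_bin// fmorph_div rmorphM rmorphXn !rmorph_nat.
Qed.


(* As the effects have rank one, the product on the left depends on [a] and [b]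
   only through their weights, so that the sums can be read off the generating
   function [bloch_form_moment]. *)
Lemma bloch_tensor_sum k (a b : {ffun 'I_k -> 'I_2}) : (k <= 5)%N ->
  \sum_l \prod_(m < k) bloch_mx (n l) (a m) (b m) =
    (wt a == wt b)%:R * (12 * 2 ^+ k / k.+1%:R) / 'C(k, wt a)%:R.
Proof.
move=> k5.
have rk l := bloch_mx_rank1 (dotv_self hn l).
(* The product at indices of weights [i] and [j], expressed by chosen rank-one factors of
   [bloch_mx (n l)]. *)
pose T (i j : nat) l : C :=
  let p := projT1 (cid (rk l)) in let q := projT1 (cid (projT2 (cid (rk l)))) in
  (p 0 ^+ (k - i) * p 1 ^+ i) * (q 0 ^+ (k - j) * q 1 ^+ j).
have Tprod l : \prod_(m < k) bloch_mx (n l) (a m) (b m) = T (wt a) (wt b) l.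
  rewrite /T; case: cid => p /= ex; case: cid => q /= pq.
  by rewrite (eq_bigr _ (fun m _ => pq _ _)) big_split !prod_wt.
have Tform l x y : form (n l) x y ^+ k =
    \sum_(i < k.+1) \sum_(j < k.+1)
      ('C(k, i)%:R * 'C(k, j)%:R * T i j l) * x ^+ i * y ^+ j.
  rewrite /T; case: cid => p /= ex; case: cid => q /= pq.
  have -> : form (n l) x y = (p 0 + p 1 * x) * (q 0 + q 1 * y).
    rewrite !sum_ord2 !pq /=.
    by rewrite !expr1 !expr0; ring.
  rewrite exprMn !exprDn big_distrlr /=; apply: eq_bigr => i _.
  apply: eq_bigr => j _; rewrite -[_ *+ 'C(k, i)]mulr_natl.
  by rewrite -[_ *+ 'C(k, j)]mulr_natl !exprMn; ring.
set S := fun i j : nat => \sum_l T i j l.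
(* The family is the coefficient of [x ^+ i * y ^+ j] in the difference of two expansions of the
   generating function: by rank-one factors, and by the binomial formula for [(1 + x * y) ^+ k]. *)
have K0 := @bivariate_eq0 _ k.+1 (fun i j => 'C(k, i)%:R * 'C(k, j)%:R * S i j -
   (i == j)%:R * ('C(k, i)%:R * (12 * 2 ^+ k / k.+1%:R))) _.
have := K0 _ (inord (wt a)) (inord (wt b)).
rewrite -(inj_eq val_inj) /= !inordK ?ltnS ?wt_le// => {}K0.
rewrite (eq_bigr _ (fun l _ => Tprod l)) -/(S _ _).
have Cn0 (c : {ffun 'I_k -> 'I_2}) : 'C(k, wt c)%:R != 0 :> C.
  by rewrite pnatr_eq0 -lt0n bin_gt0 wt_le.
have {}K0 : 'C(k, wt a)%:R * 'C(k, wt b)%:R * S (wt a) (wt b) =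
   (wt a == wt b)%:R * ('C(k, wt a)%:R * (12 * 2 ^+ k / k.+1%:R)).
  apply/eqP; rewrite -subr_eq0; apply/eqP/K0 => x y.
  pose c := 12 * 2 ^+ k / k.+1%:R : C.
  have e1 : \sum_(i < k.+1) \sum_(j < k.+1)
      'C(k, i)%:R * 'C(k, j)%:R * S i j * x ^+ i * y ^+ j =
      c * (1 + x * y) ^+ k.
    rewrite -bloch_form_moment//.
    rewrite (eq_bigr _ (fun l _ => Tform l x y)) [RHS]exchange_big /=.
    apply: eq_bigr => i _; rewrite [RHS]exchange_big /=; apply: eq_bigr => j _.
    by rewrite -!mulr_suml -mulr_sumr.
  have e2 : c * (1 + x * y) ^+ k = \sum_(i < k.+1) \sum_(j < k.+1)
      (i == j)%:R * ('C(k, i)%:R * c) * x ^+ i * y ^+ j.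
    rewrite exprDn mulr_sumr; apply: eq_bigr => i _.
    rewrite (bigD1 i)//= big1 => [|j ji].
      rewrite eqxx mul1r addr0 expr1n mul1r exprMn -[_ *+ 'C(k, i)]mulr_natl.
      by move: (c) => c'; ring.
    by rewrite eq_sym (negbTE ji) !mul0r.
  transitivity (c * (1 + x * y) ^+ k - c * (1 + x * y) ^+ k); last exact: subrr.
  rewrite -{1}e1 e2 -sumrB; apply: eq_bigr => i _; rewrite -sumrB.
  by apply: eq_bigr => j _; rewrite !mulrBl.
have [ab|ab] := eqVneq (wt a) (wt b); last first.
  move: K0; rewrite (negbTE ab) !mul0r => /eqP.
  by rewrite !mulf_eq0 !(negbTE (Cn0 _)) /= => /eqP.
move: K0; rewrite -ab eqxx !mul1r -mulrA => /(mulfI (Cn0 a)) <-.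
by rewrite mulrC mulKf.
Qed.

Lemma bloch_povm_tr y : \tr (bloch_povm n y) = 6^-1.
Proof.
rewrite /bloch_povm mxtraceZ mxtraceD mxtrace1.
have -> : \tr (dot_pauli (n y)) = 0.
  by rewrite /mxtrace sum_ord2; case: (dot_pauliE (n y)) => -> _ _ ->;
    rewrite subrr.
by rewrite addr0; field.
Qed.

Lemma icosahedral_design_eq k : (1 <= k <= 5)%N ->
  \sum_y (\tr (bloch_povm n y) ^+ (k - 1))^-1 *:
      tensor_power k (bloch_povm n y) =
    (2%:R / 'C(2 - 1 + k, k)%:R) *: proj_sym R 2 k.
Proof.
move=> /andP[k1 k5]; rewrite proj_symE; apply/matrixP => a b.
rewrite summxE !mxE.
(* Each effect is a twelfth of a Bloch matrix and has trace [1 / 6]. *)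
rewrite (eq_bigr (fun l => 6 ^+ (k - 1) / 12 ^+ k *
    \prod_(m < k) bloch_mx (n l) (tensor_index a m) (tensor_index b m))).
  rewrite -mulr_sumr bloch_tensor_sum//; set w := (_ == _)%:R.
  set c := 'C(k, _)%:R.
  have -> : 'C(2 - 1 + k, k) = k.+1 by exact: binSn.
  have e : 6 ^+ (k - 1) / 12 ^+ k * (12 * 2 ^+ k / k.+1%:R) =
      2%:R / k.+1%:R :> C.
    case: k k1 {k5 a b w c} => // k _; rewrite subSS subn0 !exprS.
    have -> : 12 = 6 * 2 :> C by ring.
    rewrite exprMn; field.
    apply/and3P; split; first by rewrite -natrD pnatr_eq0.
      by rewrite expf_neq0// pnatr_eq0.
    by rewrite expf_neq0// pnatr_eq0.
  by rewrite -e; ring.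
move=> l _; rewrite !mxE bloch_povm_tr exprVn invrK -mulrA; congr (_ * _).
rewrite -exprVn -[k in X in X * _]card_ord -prodr_const -big_split /=.
by apply: eq_bigr => m _; rewrite mxE.
Qed.

End Design.

(** * The upper bound on the mutual information *)

Section Power.
Local Open Scope complex_scope.
Local Open Scope sesquilinear_scope.
Variable R : realType.
Local Notation C := R[i].
Variables (n : 'I_12 -> 'rV[R]_3) (hn : icosahedron_vertices n).
Local Notation dotR := (dotv (idfun : {rmorphism R -> R})).

(** The cosine [1 / sqrt 5] of the angle between adjacent vertices. *)
Definition cos_nbr : R := Num.sqrt 5 / 5.
Local Notation alpha := cos_nbr.

Lemma cos_nbr_sqr : alpha ^+ 2 = 1 / 5.
Proof. by rewrite /cos_nbr exprMn sqr_sqrtr//; field. Qed.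

Lemma cos_nbr_itv : 0 < alpha < 1.
Proof.
have a0 : 0 < alpha by rewrite /cos_nbr divr_gt0// sqrtr_gt0.
by rewrite a0 /=; have := cos_nbr_sqr; nra.
Qed.

(** Seen from the opposite of a vertex, [1 + n_y . u] takes the values 2 and 0 once each and
    [1 + alpha], [1 - alpha] five times each; the value 0 contributes nothing. *)
Definition max_info : R :=
  (xlnx 2 + 5 * xlnx (1 + alpha) + 5 * xlnx (1 - alpha)) / 12.

(** The argument of the last logarithm is [(1 - alpha) / (1 + alpha)], and
    [(1 + alpha) * (1 - alpha) = 4 / 5] brings in [ln 5]. *)
Lemma max_infoE : max_info =
  ln 2 - 5 / 12 * ln 5 - Num.sqrt 5 / 12 * ln ((9 - 3 * Num.sqrt 5) / 6).
Proof.
have /andP[a0 a1] := cos_nbr_itv.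
have p1 : 0 < 1 + alpha by lra.
have m1 : 0 < 1 - alpha by lra.
have s5 : Num.sqrt 5 ^+ 2 = 5 :> R by rewrite sqr_sqrtr.
have -> : (9 - 3 * Num.sqrt 5) / 6 = (1 - alpha) / (1 + alpha).
  have n1 : 1 + alpha != 0 by rewrite gt_eqF.
  by apply: (mulIf n1); rewrite divfK// /cos_nbr; field: s5.
rewrite ln_div ?posrE//.
have e : ln (1 + alpha) + ln (1 - alpha) = 2 * ln 2 - ln 5.
  rewrite -lnM ?posrE//.
  have -> : (1 + alpha) * (1 - alpha) = 2 ^+ 2 / 5.
    by transitivity (1 - alpha ^+ 2); [ring|rewrite cos_nbr_sqr; field].
  by rewrite ln_div ?posrE ?exprn_gt0// lnXn// mulr_natl.
rewrite /max_info /xlnx.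
have -> : ln 5 = 2 * ln 2 - (ln (1 + alpha) + ln (1 - alpha)).
  by rewrite e; ring.
by rewrite /cos_nbr; field.
Qed.

Lemma max_info_ge0 : 0 <= max_info.
Proof.
have /andP[a0 a1] := cos_nbr_itv.
have h2 := @subr1_le_xlnx R 2 _; have hp := @subr1_le_xlnx R (1 + alpha) _.
have hm := @subr1_le_xlnx R (1 - alpha) _.
rewrite /max_info divr_ge0//.
have := h2 ltac:(lra); have := hp ltac:(lra); have := hm ltac:(lra); lra.
Qed.

(** The right-hand side is a quadrature rule with the same moments up to degree 5 as the
    vertices. *)
Lemma sum_poly_vertices (p : {poly R}) (u : 'cV[R]_3) : (size p <= 6)%N ->
    sqnorm u = 1 ->
  \sum_y p.[1 + dotR (n y) u] =
    p.[0] + p.[2] + 5 * p.[1 + alpha] + 5 * p.[1 - alpha].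
Proof.
move=> sp u1; pose q := p \Po ('X + 1).
have qE z : p.[1 + z] = \sum_(i < 6) q`_i * z ^+ i.
  rewrite -horner_coef_wide; first by rewrite /q horner_comp !hornerE addrC.
  rewrite (leq_trans (size_comp_poly_leq _ _))//.
  by rewrite -[1](opprK) -polyCN size_XsubC muln1; case: (size p) sp.
rewrite (eq_bigr _ (fun y _ => qE _)) exchange_big /=.
have e (i : 'I_6) : \sum_y q`_i * (dotR (n y) u) ^+ i = q`_i * moment R i.
  by rewrite -mulr_sumr icosahedron_moment ?u1 ?expr1n ?mulr1// -ltnS.
rewrite (eq_bigr _ (fun i _ => e i)).
have -> : p.[0] = \sum_(i < 6) q`_i * (-1) ^+ i by rewrite -qE subrr.
have -> : p.[2] = \sum_(i < 6) q`_i * 1 ^+ i by rewrite -qE.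
rewrite !qE !mulr_sumr -!big_split /=; apply: eq_bigr => i _.
have a2 := cos_nbr_sqr.
have a4 : alpha ^+ 4 = 1 / 25 by rewrite (exprM _ 2 2) a2; field.
have n2 : (- alpha) ^+ 2 = 1 / 5 by rewrite sqrrN.
have n4 : (- alpha) ^+ 4 = 1 / 25 by rewrite (exprM _ 2 2) sqrrN -exprM.
by case: i => [[|[|[|[|[|[|]]]]]] //=] _;
  rewrite /moment /= ?a2 ?n2 ?a4 ?n4; field.
Qed.


Lemma cos_nbr_nodes : [/\ 0 < 1 - alpha, 1 - alpha < 1 + alpha & 1 + alpha < 2].
Proof. by have /andP[? ?] := cos_nbr_itv; split; lra. Qed.

(** The difference is the squared length of the part of [u] orthogonal to the unit vector [n y]. *)
Lemma dotv_sqr_le y (u : 'cV[R]_3) : dotR (n y) u ^+ 2 <= sqnorm u.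
Proof.
have n1 := dotv_self hn y; rewrite -subr_ge0; set t := dotR (n y) u.
have -> : sqnorm u - t ^+ 2 = sqnorm (u - t *: (n y)^T).
  have tE : t = n y 0 0 * u 0 0 + n y 0 1 * u 1 0 + n y 0 2%:R * u 2%:R 0.
    by rewrite /t dotvE.
  transitivity (sqnorm u - 2 * t * t + t ^+ 2 * dotR (n y) (n y)^T).
    by rewrite n1; ring.
  by rewrite {2}tE !sqnormE dotvE !mxE /=; ring.
by rewrite sqnormE !addr_ge0 ?sqr_ge0.
Qed.

Lemma dotv_norm_le1 y (u : 'cV[R]_3) : sqnorm u = 1 -> -1 <= dotR (n y) u <= 1.
Proof.
move=> u1; rewrite -ler_norml -(@expr_le1 _ 2)// real_normK ?num_real// -u1.
exact: dotv_sqr_le.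
Qed.

Lemma sum_xlnx_sphere (u : 'cV[R]_3) : sqnorm u = 1 ->
  \sum_y xlnx (1 + dotR (n y) u) <= 12 * max_info.
Proof.
move=> u1; have [l1 l2 l3] := cos_nbr_nodes.
have [p sp hp] := hermite_xlnx_exists l1 l2 l3.
have pE : \sum_y p.[1 + dotR (n y) u] = 12 * max_info.
  rewrite sum_poly_vertices//; case: hp => [[p0 pa pb pc] _ _].
  by rewrite p0 pa pb pc /max_info; field.
rewrite -pE; apply: ler_sum => y _.
apply: (hermite_xlnx_ge l1 l2 l3 sp hp).
have /andP[? ?] := dotv_norm_le1 y u1; apply/andP; split; lra.
Qed.

Lemma sum_xlnx_anti x :
  \sum_y xlnx (1 - dotR (n x) (n y)^T) = 12 * max_info.
Proof.
have [l1 l2 l3] := cos_nbr_nodes.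
have [p sp hp] := hermite_xlnx_exists l1 l2 l3.
pose u := - (n x)^T.
have uE y : dotR (n y) u = - dotR (n x) (n y)^T.
  by rewrite !dotvE !mxE /=; ring.
have u1 : sqnorm u = 1.
  by rewrite -[RHS](dotv_self hn x) sqnormE dotvE !mxE /=; ring.
have := sum_poly_vertices sp u1; case: hp => [[p0 pa pb pc] _ _].
rewrite p0 pa pb pc => pE.
transitivity (\sum_y p.[1 + dotR (n y) u]); last first.
  by rewrite pE /max_info; field.
apply: eq_bigr => y _; rewrite uE.
have [->|[->|]] := dotv_vertices hn x y.
- by rewrite subrr p0 xlnx0.
- by rewrite opprK pc.
- move=> t2; have /eqP : dotR (n x) (n y)^T ^+ 2 = alpha ^+ 2.
    by rewrite cos_nbr_sqr.
  rewrite eqf_sqr => /orP[/eqP->|/eqP->]; first by rewrite pa.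
  by rewrite opprK pb.
Qed.

Lemma sum_dotv_vertices (u : 'cV[R]_3) : \sum_y dotR (n y) u = 0.
Proof.
have := @icosahedron_moment _ _ hn _ (idfun : {rmorphism R -> R}) u 1 isT.
move=> e; transitivity (\sum_y dotR (n y) u ^+ 1).
  by apply: eq_bigr => y _; rewrite expr1.
by rewrite e /moment /= mul0r.
Qed.

(** Convexity reduces mixed states to pure ones: [m / q] is a unit vector scaled by a factor between
    0 and 1. The case [m = 0], which has no direction, is separate. *)
Lemma sum_xlnx_ball (q : R) (m : 'cV[R]_3) : 0 < q -> sqnorm m <= q ^+ 2 ->
  \sum_y xlnx (1 + dotR (n y) m / q) <= 12 * max_info.
Proof.
move=> q0 mq; have q1 : q != 0 by rewrite gt_eqF.
move: max_info_ge0 sum_xlnx_sphere; move: max_info => W W0 sphere.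
have W12 : 0 <= 12 * W by rewrite mulr_ge0.
have sm0 : 0 <= sqnorm m by rewrite sqnormE !addr_ge0 ?sqr_ge0.
have [m0|m0] := eqVneq (sqnorm m) 0.
  have /andP[/andP[]] : [&& (m 0 0 == 0) && (m 1 0 == 0) & m 2%:R 0 == 0].
    move/eqP: m0; rewrite sqnormE paddr_eq0 ?addr_ge0 ?sqr_ge0//.
    by rewrite paddr_eq0 ?sqr_ge0// !sqrf_eq0.
  move=> /eqP m00 /eqP m10 /eqP m20.
  rewrite big1// => y _.
  by rewrite dotvE m00 m10 m20 !mulr0 !addr0 mul0r addr0 xlnx1.
pose r := Num.sqrt (sqnorm m); have r0 : 0 < r by rewrite sqrtr_gt0 lt_def m0.
have rr : r ^+ 2 = sqnorm m by rewrite sqr_sqrtr.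
pose u := r^-1 *: m.
have u1 : sqnorm u = 1.
  have -> : sqnorm u = r ^- 2 * sqnorm m.
    by rewrite !sqnormE !mxE; field; rewrite gt_eqF.
  by rewrite -rr mulVf// expf_neq0// gt_eqF.
have rq : 0 <= r / q <= 1.
  apply/andP; split; first by rewrite divr_ge0// ltW.
  rewrite ler_pdivrMr// mul1r.
  by rewrite -(@ler_pXn2r _ 2) ?nnegrE ?(ltW r0) ?(ltW q0)// rr.
apply: (@le_trans _ _ (\sum_y (r / q) * xlnx (1 + dotR (n y) u))).
  apply: ler_sum => y _.
  have -> : dotR (n y) m / q = (r / q) * dotR (n y) u.
    by rewrite !dotvE !mxE /=; field; rewrite q1 gt_eqF.
  apply: xlnx_convex1 => //.
  by have /andP[? ?] := dotv_norm_le1 y u1; lra.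
rewrite -mulr_sumr.
apply: le_trans (ler_wpM2l _ (sphere u u1)) _; first by case/andP: rq.
by rewrite ler_piMl//; case/andP: rq.
Qed.

(** The real parts of the traces of [rho] times the Pauli matrices, not divided by the trace of
    [rho]. *)
Definition bloch_vec (rho : 'M[C]_2) : 'cV[R]_3 :=
  \col_i (if i == 0 then complex.Re (rho 0 1) + complex.Re (rho 1 0)
          else if i == 1 then complex.Im (rho 1 0) - complex.Im (rho 0 1)
          else complex.Re (rho 0 0) - complex.Re (rho 1 1)).

Lemma mxtrace2E (A : 'M[C]_2) : \tr A = A 0 0 + A 1 1.
Proof. exact: sum_ord2. Qed.

Lemma mulmx2E m p (A : 'M[C]_(m, 2)) (B : 'M[C]_(2, p)) i j :
  (A *m B) i j = A i 0 * B 0 j + A i 1 * B 1 j.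
Proof. by rewrite mxE sum_ord2. Qed.

Lemma rtr2E (rho : 'M[C]_2) :
  rtr rho = complex.Re (rho 0 0) + complex.Re (rho 1 1).
Proof. by rewrite /rtr mxtrace2E; case: (rho 0 0) (rho 1 1) => ? ? []. Qed.

Lemma scalemxE m p (c : C) (A : 'M[C]_(m, p)) i j : (c *: A) i j = c * A i j.
Proof. by rewrite mxE. Qed.

Lemma rtr_bloch (rho : 'M[C]_2) y :
  rtr (rho *m bloch_povm n y) = (rtr rho + dotR (n y) (bloch_vec rho)) / 12.
Proof.
have -> : rho *m bloch_povm n y = (12^-1)%:C *: (rho *m bloch_mx (n y)).
  rewrite /bloch_povm -scalemxAr -/(bloch_mx _).
  by rewrite fmorphV rmorph_nat.
rewrite /rtr !mxtrace2E !scalemxE -mulrDr !mulmx2E dotvE.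
case: (bloch_mxE (n y)) => -> -> -> ->; rewrite /bloch_vec !mxE /=.
case: (rho 0 0) (rho 0 1) (rho 1 0) (rho 1 1) => a a' [b b'] [c c'] [d d'] /=.
by field.
Qed.

(** The quadratic form is tested on vectors with real first coordinate: basis vectors bound the
    diagonal, an eigenvector of [m . sigma] bounds the length. *)
Lemma psd_bloch (rho : 'M[C]_2) : psd rho ->
  0 <= rtr rho /\ sqnorm (bloch_vec rho) <= rtr rho ^+ 2.
Proof.
move=> hrho.
have pos (x y1 y2 : R) : 0 <= complex.Re (rho 0 0) * x ^+ 2 +
    complex.Re (rho 1 1) * (y1 ^+ 2 + y2 ^+ 2) +
    x * (y1 * bloch_vec rho 0 0 + y2 * bloch_vec rho 1 0).
  pose v : 'cV[C]_2 := \col_i (if i == 0 then x%:C else (y1 +i* y2)).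
  have := hrho v; rewrite lecE => /andP[_].
  rewrite !mulmx2E !mxE /= /bloch_vec.
  case: (rho 0 0) (rho 0 1) (rho 1 0) (rho 1 1) => a a' [b b'] [c c'] [d d'] /=.
  move=> h; apply: le_trans h _; rewrite le_eqVlt.
  by apply/orP; left; apply/eqP; ring.
move: pos; rewrite rtr2E sqnormE.
have : bloch_vec rho 2%:R 0 = complex.Re (rho 0 0) - complex.Re (rho 1 1).
  by rewrite mxE.
move: (complex.Re (rho 0 0)) (complex.Re (rho 1 1)) (bloch_vec rho 0 0)
  (bloch_vec rho 1 0) (bloch_vec rho 2%:R 0).
move=> A D m1 m2 m3 {hrho} m3E pos.
have A0 : 0 <= A by have := pos 1 0 0; lra.
have D0 : 0 <= D by have := pos 0 1 0; lra.
split; first exact: addr_ge0.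
set S := m1 ^+ 2 + m2 ^+ 2 + m3 ^+ 2.
have S0 : 0 <= S by rewrite !addr_ge0 ?sqr_ge0.
pose r := Num.sqrt S; have r0 : 0 <= r by rewrite sqrtr_ge0.
have rr : r ^+ 2 = S by rewrite sqr_sqrtr.
rewrite -rr ler_pXn2r ?nnegrE ?addr_ge0//.
have m3r : m3 <= r.
  rewrite (le_trans (ler_norm _))// -(@ler_pXn2r _ 2) ?nnegrE//.
  rewrite real_normK ?num_real// rr.
  by rewrite lerDr addr_ge0 ?sqr_ge0.
(* For [m3 = r] the test vector used below is zero, but then [r = A - D <= A + D]. *)
move: m3r; rewrite le_eqVlt => /predU1P[<-|m3r]; first by rewrite m3E; lra.
(* [(m3 - r, m1 + i m2)] is the eigenvector of [m . sigma] for [- r]. *)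
have := pos (m3 - r) m1 m2.
have -> : A * (m3 - r) ^+ 2 + D * (m1 ^+ 2 + m2 ^+ 2) +
    (m3 - r) * (m1 * m1 + m2 * m2) =
    (r - m3) * (r * (A + D - r)).
  have -> : m1 * m1 + m2 * m2 = r ^+ 2 - m3 ^+ 2 by rewrite rr /S; ring.
  by rewrite m3E; ring.
rewrite pmulr_rge0 ?subr_gt0//; move: r0; rewrite le_eqVlt => /predU1P[<- _|r0].
  exact: addr_ge0.
by rewrite pmulr_rge0// subr_ge0.
Qed.


Lemma rtr_bloch_ge0 (rho : 'M[C]_2) y : psd rho ->
  0 <= rtr (rho *m bloch_povm n y).
Proof.
move=> /psd_bloch[q0 mq]; rewrite rtr_bloch divr_ge0//.
have : `|dotR (n y) (bloch_vec rho)| <= rtr rho.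
  rewrite -(@ler_pXn2r _ 2) ?nnegrE// real_normK ?num_real//.
  exact: le_trans (dotv_sqr_le _ _) mq.
by rewrite ler_norml => /andP[]; lra.
Qed.

Lemma rtr_bloch_sum (rho : 'M[C]_2) :
  \sum_y rtr (rho *m bloch_povm n y) = rtr rho.
Proof.
rewrite (eq_bigr _ (fun y _ => rtr_bloch rho y)) -mulr_suml big_split /=.
by rewrite sum_dotv_vertices addr0 sumr_const card_ord; field.
Qed.

(** The logarithm splits into [ln (12 p / q)] and [ln (12 r)^-1]; the latter is bounded by its
    tangent at 1, so that the correction is linear in [p] and can be summed over the input. *)
Lemma info_term_le (p q r : R) :
  0 <= p -> 0 < q -> 0 <= r -> (r = 0 -> p = 0) ->
  info_term p q r <= q / 12 * xlnx (12 * p / q) + p / (12 * r) - p.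
Proof.
move=> p0 q0 r0 rp; rewrite /info_term; case: eqP => [->|/eqP pn0].
  by rewrite mulr0 !mul0r xlnx0 mulr0 addr0 subr0.
have {pn0}p0 : 0 < p by rewrite lt_def pn0.
have {rp}r0 : 0 < r.
  by rewrite lt_def r0 andbT; apply/eqP => /rp pE; rewrite pE ltxx in p0.
have q1 : q != 0 by rewrite gt_eqF.
have -> : q / 12 * xlnx (12 * p / q) = p * ln (12 * p / q).
  by rewrite /xlnx; field.
have -> : p / (q * r) = (12 * p / q) * (12 * r)^-1.
  by field; rewrite q1 gt_eqF.
rewrite lnM ?posrE ?divr_gt0 ?invr_gt0 ?mulr_gt0// mulrDr -addrA lerD2l.
have := @ln_le_subr1 _ (12 * r)^-1; rewrite invr_gt0 mulr_gt0// => /(_ isT).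
by move=> /(ler_wpM2l (ltW p0)); rewrite mulrBr mulr1.
Qed.

(** Division by the trace makes [sum_xlnx_ball] applicable; at trace zero all terms vanish. The
    distribution [r] stays free, to be supplied by a sum or by an integral. *)
Lemma info_sum_le (rho : 'M[C]_2) (r : 'I_12 -> R) : psd rho ->
    (forall y, 0 <= r y) ->
    (forall y, r y = 0 -> rtr (rho *m bloch_povm n y) = 0) ->
  \sum_y info_term (rtr (rho *m bloch_povm n y))
                   (\sum_y rtr (rho *m bloch_povm n y)) (r y) <=
  rtr rho * max_info + \sum_y rtr (rho *m bloch_povm n y) / (12 * r y) -
    rtr rho.
Proof.
move=> hrho r0 rp; rewrite rtr_bloch_sum.
have [] := psd_bloch hrho; set q := rtr rho; rewrite le_eqVlt.
move=> /predU1P[q0 _|q0 mq].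
  have p0 y : rtr (rho *m bloch_povm n y) = 0.
    apply/eqP; have := rtr_bloch_sum rho; rewrite -/q -q0 => /eqP.
    rewrite psumr_eq0 => [/allP/(_ y (mem_index_enum _))//|i _].
    exact: rtr_bloch_ge0.
  rewrite -q0 mul0r add0r subr0 !big1// => y _; first by rewrite p0 mul0r.
  by rewrite p0 /info_term eqxx.
have term y := info_term_le (rtr_bloch_ge0 y hrho) q0 (r0 y) (rp y).
apply: le_trans (ler_sum _ (fun y _ => term y)) _.
rewrite sumrB big_split /= -mulr_sumr rtr_bloch_sum -/q lerD2r lerD2r.
rewrite -mulrA ler_pM2l// [12^-1 * _]mulrC ler_pdivrMr//.
have := sum_xlnx_ball q0 mq; rewrite [max_info * _]mulrC; apply: le_trans.
apply: ler_sum => y _; rewrite rtr_bloch -/q.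
have -> // : 12 * ((q + dotR (n y) (bloch_vec rho)) / 12) / q =
  1 + dotR (n y) (bloch_vec rho) / q.
by field; rewrite gt_eqF.
Qed.

(** A term is [1 / 12], or 0 when [r y = 0], division by zero giving 0. *)
Lemma sum_div_le1 (r : 'I_12 -> R) : \sum_y r y / (12 * r y) <= 1.
Proof.
apply: (@le_trans _ _ (\sum_(y < 12) 12^-1)); last first.
  by rewrite sumr_const card_ord le_eqVlt; apply/orP; left; apply/eqP; field.
apply: ler_sum => y _; have [->|r0] := eqVneq (r y) 0.
  by rewrite mul0r invr_ge0.
by rewrite invfM mulrCA divff// mulr1.
Qed.

(** Summed over the input, the corrections of [info_sum_le] total at most 1, which the total trace 1
    cancels. *)
Lemma finite_mutual_info_le M (rho : 'I_M -> 'M[C]_2) : finite_ensemble rho ->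
  finite_mutual_info rho (bloch_povm n) <= max_info.
Proof.
move=> [hrho rho1]; rewrite /finite_mutual_info.
set r := fun y => \sum_x rtr (rho x *m bloch_povm n y).
have r0 y : 0 <= r y by apply: sumr_ge0 => x _; exact: rtr_bloch_ge0.
have rp x y : r y = 0 -> rtr (rho x *m bloch_povm n y) = 0.
  move=> /eqP; rewrite psumr_eq0 => [/allP/(_ x (mem_index_enum _))/eqP//|i _].
  exact: rtr_bloch_ge0.
apply: le_trans (ler_sum _ (fun x _ => info_sum_le (hrho x) r0 (rp x))) _.
rewrite sumrB big_split /= -mulr_suml rho1 mul1r exchange_big /=.
rewrite -addrA gerDl subr_le0.
rewrite (eq_bigr (fun y => r y / (12 * r y))); last first.
  by move=> y _; rewrite mulr_suml.
exact: sum_div_le1.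
Qed.


End Power.

(** * From finite sums to integrals over the input *)

(** Positive and negative parts are compared separately, which also covers an [f] whose negative
    part has infinite integral. *)
Lemma le_integral_ae d (T : measurableType d) (R : realType)
    (mu : {measure set T -> \bar R}) (f g : T -> \bar R) :
  measurable_fun [set: T]%classic f -> measurable_fun [set: T]%classic g ->
  {ae mu, forall x, (f x <= g x)%E} ->
  (\int[mu]_x f x <= \int[mu]_x g x)%E.
Proof.
move=> mf mg fg; rewrite [leLHS]integralE [leRHS]integralE; apply: leeB.
- apply: ae_ge0_le_integral => //;
    [exact: measurable_funepos|exact: measurable_funepos|].
  apply: filterS fg => x fgx _.
  by rewrite !funeposE ge_max !le_max lexx fgx orbT.
- apply: ae_ge0_le_integral => //;
    [exact: measurable_funeneg|exact: measurable_funeneg|].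
  apply: filterS fg => x fgx _.
  by rewrite !funenegE ge_max !le_max lexx leeN2 fgx orbT.
Qed.

Lemma ae_eq0_integral d (T : measurableType d) (R : realType)
    (mu : {measure set T -> \bar R}) (f : T -> R) :
  measurable_fun [set: T]%classic f -> (forall x, 0 <= f x) ->
  (\int[mu]_x (f x)%:E = 0)%E -> {ae mu, forall x, f x = 0}.
Proof.
move=> mf f0 If; have mE : measurable_fun [set: T]%classic (EFin \o f).
  exact/measurable_EFinP.
have [+ _] := ae_eq_integral_abs mu measurableT mE.
move=> h; have {}h : ae_eq mu setT (EFin \o f) (cst 0%E).
  apply: h; rewrite -[RHS]If; apply: eq_integral => x _ /=.
  by rewrite ger0_norm.
by apply: filterS h => x /(_ I) /= [].
Qed.

Section IntegralInfo.
Context d (T : measurableType d) (R : realType).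
Variable mu : {measure set T -> \bar R}.
Variables (p : 'I_12 -> T -> R) (W : R).
Local Notation q x := (\sum_y p y x).
Hypothesis mp : forall y, measurable_fun [set: T]%classic (p y).
Hypothesis p0 : forall y x, 0 <= p y x.
Hypothesis int_q : (\int[mu]_x (q x)%:E = 1)%E.
Hypothesis info_sum_le : forall x (r : 'I_12 -> R), (forall y, 0 <= r y) ->
  (forall y, r y = 0 -> p y x = 0) ->
  \sum_y info_term (p y x) (q x) (r y) <=
  q x * W + \sum_y p y x / (12 * r y) - q x.

Let q0 x : 0 <= q x. Proof. by rewrite sumr_ge0. Qed.

Let mq : measurable_fun [set: T]%classic (fun x => q x).
Proof. exact: measurable_sum. Qed.

Let iq : mu.-integrable [set: T]%classic (fun x => (q x)%:E).
Proof.
apply/integrableP; split; first exact/measurable_EFinP.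
under eq_integral do rewrite /= ger0_norm ?q0//.
by rewrite int_q ltry.
Qed.

Let ip y : mu.-integrable [set: T]%classic (fun x => (p y x)%:E).
Proof.
apply: le_integrable iq => //; first exact/measurable_EFinP.
move=> x _ /=; rewrite lee_fin !ger0_norm ?q0 ?p0// (bigD1 y)//=.
by rewrite lerDl sumr_ge0.
Qed.

Let r y : R := \int[mu]_x p y x.

Let r0 y : 0 <= r y. Proof. by apply: Rintegral_ge0. Qed.

Let rE y : (\int[mu]_x (p y x)%:E = (r y)%:E)%E.
Proof. by rewrite fineK//; exact: integrable_fin_num. Qed.

(* If [r y = 0], the [y]-th term of the mutual information is the junk value
   [p * ln 0 = 0], but [p y] vanishes almost everywhere. *)
Let p_eq0 : {ae mu, forall x, forall y, r y = 0 -> p y x = 0}.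
Proof.
pose z x := \sum_(y | r y == 0) p y x.
have mz : measurable_fun [set: T]%classic z.
  by rewrite /z; under eq_fun do rewrite -big_filter; exact: measurable_sum.
have z0 x : 0 <= z x by apply: sumr_ge0.
have Iz : (\int[mu]_x (z x)%:E = 0)%E.
  under eq_integral do rewrite /z -sumEFin.
  rewrite integral_sum//; apply: big1 => y /eqP ry.
  by rewrite rE ry.
apply: filterS (ae_eq0_integral mz z0 Iz) => x zx y ry.
move/eqP: zx; rewrite psumr_eq0// => /allP/(_ y (mem_index_enum _)).
by rewrite ry eqxx => /eqP.
Qed.

Let f x : R := \sum_y info_term (p y x) (q x) (r y).

Let g x : R := (W - 1) * q x + \sum_y (12 * r y)^-1 * p y x.

(** A form free of case distinctions on [x], from which measurability is immediate; the indicator of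
    [r y != 0] accounts for the default value [ln 0 = 0]. *)
Let fE x : f x =
  \sum_y p y x * ((r y != 0)%:R * (ln (p y x) - ln (q x) - ln (r y))).
Proof.
apply: eq_bigr => y _; rewrite /info_term; case: eqP => [->|/eqP pn0].
  by rewrite mul0r.
have [->|rn0] := eqVneq (r y) 0; first by rewrite mulr0 invr0 mulr0 ln0// mul0r.
have pp : 0 < p y x by rewrite lt_def pn0 p0.
have qp : 0 < q x.
  apply: lt_le_trans pp _; rewrite (bigD1 y)//=.
  by rewrite lerDl sumr_ge0.
have rp : 0 < r y by rewrite lt_def rn0 r0.
by rewrite ln_div ?lnM ?posrE ?mulr_gt0// mul1r opprD addrA.
Qed.

Let mf : measurable_fun [set: T]%classic f.
Proof.
rewrite (funext fE).
apply: measurable_sum => y; apply: measurable_funM => //.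
apply: measurable_funM => //; apply: measurable_funB => //.
by apply: measurable_funB; apply: measurableT_comp => //; exact: measurable_ln.
Qed.

Let mg : measurable_fun [set: T]%classic g.
Proof.
apply: measurable_funD; first exact: measurable_funM.
by apply: measurable_sum => y; exact: measurable_funM.
Qed.

Let fg : {ae mu, forall x, f x <= g x}.
Proof.
apply: filterS p_eq0 => x px.
apply: le_trans (info_sum_le r0 px) _.
rewrite /g mulrBl mul1r addrAC [W * _]mulrC lerD2l.
by apply: ler_sum => y _; rewrite mulrC.
Qed.

(** The integral of [g] is [W - 1] plus the sum bounded by 1 in [sum_div_le1]. *)
Let int_g : (\int[mu]_x (g x)%:E <= W%:E)%E.
Proof.
have ipZ y : mu.-integrable setT (fun x => ((12 * r y)^-1)%:E * (p y x)%:E)%E.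
  exact: (integrableZl _ _ (ip y)).
have gE x : (g x)%:E = ((W - 1)%:E * (q x)%:E +
    \sum_y ((12 * r y)^-1)%:E * (p y x)%:E)%E.
  rewrite /g EFinD EFinM; congr (_ + _)%E; rewrite -sumEFin.
  by apply: eq_bigr => y _; rewrite EFinM.
under eq_integral do rewrite gE.
rewrite integralD//; last 2 first.
- exact: (integrableZl _ _ iq).
- exact: integrable_sum.
rewrite integralZl// integral_sum//.
under eq_bigr do rewrite integralZl// rE -EFinM.
rewrite int_q mule1 sumEFin -EFinD lee_fin.
rewrite -lerBrDl opprB [W + _]addrC subrK.
apply: le_trans (sum_div_le1 r); apply: ler_sum => y _; by rewrite mulrC.
Qed.


Lemma integral_info_le :
  (\int[mu]_x (\sum_y info_term (p y x) (q x) (\int[mu]_x p y x))%:E <= W%:E)%E.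
Proof.
apply: le_trans int_g; apply: le_integral_ae.
- exact/measurable_EFinP.
- exact/measurable_EFinP.
- by apply: filterS fg => x; rewrite lee_fin.
Qed.

End IntegralInfo.

Section MutualInfo.
Local Open Scope complex_scope.
Variable R : realType.
Local Notation C := R[i].
Variables (n : 'I_12 -> 'rV[R]_3) (hn : icosahedron_vertices n).
Local Notation mu := (@lebesgue_measure R).

Section Ensemble.
Variables (rho : R -> 'M[C]_2) (hrho : ensemble rho).

Let p y x : R := rtr (rho x *m bloch_povm n y).
Let q x : R := rtr (rho x).

Let mrho : measurable_mx rho. Proof. by case: hrho. Qed.
Let prho x : psd (rho x). Proof. by case: hrho. Qed.

Let mq : measurable_fun setT q.
Proof.
rewrite /q; under eq_fun do rewrite rtr2E.
by apply: measurable_funD; case: (mrho 0 0) (mrho 1 1) => ? _ [].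
Qed.

Let mp y : measurable_fun setT (p y).
Proof.
rewrite /p; under eq_fun do rewrite rtr_bloch dotvE !mxE /=.
apply: measurable_funM => //; apply: measurable_funD => //.
have [[m01 m01'] [m10 m10']] := (mrho 0 1, mrho 1 0).
have [[m00 _] [m11 _]] := (mrho 0 0, mrho 1 1).
apply: measurable_funD; first apply: measurable_funD.
- by apply: measurable_funM => //; exact: measurable_funD.
- by apply: measurable_funM => //; exact: measurable_funB.
- by apply: measurable_funM => //; exact: measurable_funB.
Qed.

Let p0 y x : 0 <= p y x. Proof. exact: rtr_bloch_ge0. Qed.
Let psum x : \sum_y p y x = q x. Proof. exact: rtr_bloch_sum. Qed.
Let q0 x : 0 <= q x. Proof. by rewrite -psum sumr_ge0. Qed.


Lemma mutual_info_le : (mutual_info rho (bloch_povm n) <= (max_info R)%:E)%E.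
Proof.
rewrite /mutual_info; apply: (@integral_info_le _ _ R mu p (max_info R)) => //.
- by under eq_integral do rewrite psum; case: hrho.
- move=> x r r0 rp; have := info_sum_le hn (prho x) r0 rp.
  by rewrite -(rtr_bloch_sum hn (rho x)).
Qed.

End Ensemble.
End MutualInfo.

(** * The anti-icosahedral ensemble *)

Section AntiEnsemble.
Local Open Scope complex_scope.
Local Open Scope sesquilinear_scope.
Variable R : realType.
Local Notation C := R[i].
Local Notation dotR := (dotv (idfun : {rmorphism R -> R})).

Lemma mx2P (A B : 'M[C]_2) : A 0 0 = B 0 0 -> A 0 1 = B 0 1 ->
  A 1 0 = B 1 0 -> A 1 1 = B 1 1 -> A = B.
Proof.
move=> e00 e01 e10 e11; apply/matrixP => i j.
by case: (ord2P i) => ->; case: (ord2P j) => ->.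
Qed.

Lemma dot_pauliN (v : 'rV[R]_3) : dot_pauli (- v) = - dot_pauli v.
Proof.
rewrite /dot_pauli -sumrN; apply: eq_bigr => j _.
by rewrite mxE rmorphN scaleNr.
Qed.

Lemma bloch_mxN (v : 'rV[R]_3) : bloch_mx (- v) = 2 *: 1%:M - bloch_mx v.
Proof. by rewrite /bloch_mx dot_pauliN scaler_nat mulr2n opprD addrA addrK. Qed.

(** For a unit vector [v . sigma] squares to the identity, so [bloch_mx v] is twice a projector. *)
Lemma bloch_mx_sqr (v : 'rV[R]_3) : dotR v v^T = 1 ->
  bloch_mx v *m bloch_mx v = 2 *: bloch_mx v.
Proof.
rewrite dotvE !mxE /= => v1.
have {}v1 : (v 0 0)%:C ^+ 2 + (v 0 1)%:C ^+ 2 + (v 0 2%:R)%:C ^+ 2 = 1.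
  by rewrite !expr2 -!rmorphM -!rmorphD v1.
have {}v1 : (v 0 0)%:C ^+ 2 = 1 - (v 0 1)%:C ^+ 2 - (v 0 2%:R)%:C ^+ 2.
  by rewrite -v1; ring.
have i2 := i_sqr R.
case: (bloch_mxE v) => e00 e01 e10 e11.
by apply: mx2P; rewrite mulmx2E scalemxE ?e00 ?e01 ?e10 ?e11; ring: v1 i2.
Qed.

Lemma adjmxE m p (A : 'M[C]_(m, p)) i j : A^t* i j = (A j i)^*.
Proof. by rewrite 2!mxE. Qed.

Lemma bloch_mx_herm (v : 'rV[R]_3) : (bloch_mx v)^t* = bloch_mx v.
Proof.
case: (bloch_mxE v) => e00 e01 e10 e11.
apply: mx2P; rewrite adjmxE ?e00 ?e01 ?e10 ?e11.
all: by apply/eqP; rewrite eq_complex /=; apply/andP; split; apply/eqP; ring.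
Qed.

(** As [bloch_mx v] is Hermitian and half of its own square, the form at [u] is half the squared
    length of [w]. *)
Lemma psd_bloch_mx (v : 'rV[R]_3) : dotR v v^T = 1 -> psd (bloch_mx v).
Proof.
move=> v1 u; set w := bloch_mx v *m u.
have -> : u^t* *m bloch_mx v *m u = 2^-1 *: (w^t* *m w).
  rewrite /w trmx_mul map_mxM bloch_mx_herm mulmxA.
  rewrite -(mulmxA _ (bloch_mx v) (bloch_mx v)) bloch_mx_sqr//.
  by rewrite -scalemxAr -scalemxAl scalerA mulVf// scale1r.
rewrite mxE mulr_ge0 ?invr_ge0// mxE sumr_ge0// => i _.
by rewrite !mxE mulrC mul_conjC_ge0.
Qed.

Lemma psdZ d (c : R) (A : 'M[C]_d) : 0 <= c -> psd A -> psd (c%:C *: A).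
Proof.
move=> c0 hA u; rewrite -scalemxAr -scalemxAl mxE mulr_ge0//.
by rewrite ler0c.
Qed.

Lemma rtr_scale_bloch (c : R) (v : 'rV[R]_3) : rtr (c%:C *: bloch_mx v) = 2 * c.
Proof.
rewrite rtr2E !mxE; case: (dot_pauliE v) => -> _ _ -> /=; ring.
Qed.

Lemma bloch_vec_scale (c : R) (v : 'rV[R]_3) :
  bloch_vec (c%:C *: bloch_mx v) = (2 * c) *: v^T.
Proof.
apply/matrixP => i j; rewrite ord1 {j} !mxE.
case: (bloch_mxE v); rewrite !mxE /= => -> -> -> ->.
case: i => [[|[|[|]]]] //= i3 /=.
- have -> : Ordinal i3 = 0 by apply: val_inj. ring.
- have -> : Ordinal i3 = 1 by apply: val_inj. ring.
- have -> : Ordinal i3 = 2%:R by apply: val_inj. ring.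
Qed.

Variables (n : 'I_12 -> 'rV[R]_3) (hn : icosahedron_vertices n).

Lemma bloch_povmE y : bloch_povm n y = (12^-1)%:C *: bloch_mx (n y).
Proof. by rewrite /bloch_povm fmorphV rmorph_nat. Qed.

Lemma anti_ensembleE x : anti_ensemble n x = (24^-1)%:C *: bloch_mx (- n x).
Proof.
rewrite /anti_ensemble /bloch_mx dot_pauliN fmorphV rmorph_nat.
by congr (_^-1 *: _); ring.
Qed.

Lemma dotv_self_opp x : dotR (- n x) (- n x)^T = 1.
Proof. by rewrite -(dotv_self hn x) !dotvE !mxE /=; ring. Qed.

Lemma sum_vertices j : \sum_y n y 0 j = 0.
Proof.
rewrite -[RHS](sum_dotv_vertices hn (delta_mx j 0)); apply: eq_bigr => y _.
rewrite /dotv mxE (bigD1 j)//= !mxE !eqxx mulr1 big1 ?addr0// => k kj.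
by rewrite !mxE (negbTE kj) mulr0.
Qed.

Lemma bloch_is_povm : is_povm (bloch_povm n).
Proof.
split=> [y|].
  rewrite bloch_povmE; apply: psdZ; first by rewrite invr_ge0.
  exact/psd_bloch_mx/dotv_self.
rewrite -scaler_sumr big_split /= sumr_const card_ord.
have -> : \sum_y dot_pauli (n y) = 0.
  rewrite /dot_pauli exchange_big big1// => j _.
  by rewrite -scaler_suml -rmorph_sum sum_vertices rmorph0 scale0r.
by rewrite addr0 -[_%:M *+ _]scaler_nat scalerA mulVf ?scale1r.
Qed.

Lemma icosahedral_t_design : t_design_povm 5 (bloch_povm n).
Proof.
by split=> [|k]; [exact: bloch_is_povm|exact: icosahedral_design_eq].
Qed.

Lemma anti_finite_ensemble : finite_ensemble (anti_ensemble n).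
Proof.
split=> [x|].
  rewrite anti_ensembleE; apply: psdZ; first by rewrite invr_ge0.
  exact/psd_bloch_mx/dotv_self_opp.
under eq_bigr do rewrite anti_ensembleE rtr_scale_bloch.
by rewrite sumr_const card_ord; field.
Qed.

(** The two factors are multiples of [2 - B] and [B], where [B = bloch_mx (n x)] satisfies
    [B ^+ 2 = 2 B]. *)
Lemma anti_orthogonal x : anti_ensemble n x *m bloch_povm n x = 0.
Proof.
rewrite anti_ensembleE bloch_povmE -scalemxAl -scalemxAr bloch_mxN.
by rewrite mulmxBl -scalemxAl mul1mx bloch_mx_sqr ?dotv_self// subrr !scaler0.
Qed.

Lemma anti_joint x y : rtr (anti_ensemble n x *m bloch_povm n y) =
  (1 - dotR (n x) (n y)^T) / 144.
Proof.
rewrite rtr_bloch anti_ensembleE rtr_scale_bloch bloch_vec_scale.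
by rewrite !dotvE !mxE /=; field.
Qed.

(** Both marginals are uniform, so the ratio inside the logarithm is [1 - n_x . n_y] and each input
    contributes the value of [sum_xlnx_anti] over 144. *)
Lemma anti_mutual_info :
  finite_mutual_info (anti_ensemble n) (bloch_povm n) = max_info R.
Proof.
have px x : \sum_y rtr (anti_ensemble n x *m bloch_povm n y) = 12^-1.
  by rewrite rtr_bloch_sum// anti_ensembleE rtr_scale_bloch; field.
have py y : \sum_x rtr (anti_ensemble n x *m bloch_povm n y) = 12^-1.
  under eq_bigr do rewrite anti_joint.
  rewrite -mulr_suml sumrB sumr_const card_ord.
  by rewrite (sum_dotv_vertices hn) subr0; field.
rewrite /finite_mutual_info.
have term x y :
    info_term (rtr (anti_ensemble n x *m bloch_povm n y)) 12^-1 12^-1 =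
    xlnx (1 - dotR (n x) (n y)^T) / 144.
  rewrite /info_term anti_joint /xlnx; set t := 1 - _.
  rewrite mulf_eq0 invr_eq0 pnatr_eq0 orbF.
  case: eqP => [->|_]; first by rewrite !mul0r.
  by rewrite (_ : t / 144 / (12^-1 / 12) = t); field.
rewrite (eq_bigr (fun=> 12 * max_info R / 144)) => [|x _].
  by rewrite sumr_const card_ord; field.
rewrite (eq_bigr (fun y => xlnx (1 - dotR (n x) (n y)^T) / 144)) => [|y _].
  by rewrite -mulr_suml sum_xlnx_anti.
transitivity
  (info_term (rtr (anti_ensemble n x *m bloch_povm n y)) 12^-1 12^-1).
  by congr info_term; [exact: px|exact: py].
exact: term.
Qed.

Lemma icosahedral_power : informational_power (bloch_povm n) = (max_info R)%:E.
Proof.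
apply/eqP; rewrite eq_le; apply/andP; split.
  apply: ge_ereal_sup => w [[rho [hrho ->]]|[M [rho [hrho ->]]]].
    exact: mutual_info_le.
  by rewrite lee_fin; exact: finite_mutual_info_le.
apply: ereal_sup_ubound; right; exists 12%N, (anti_ensemble n); split.
  exact: anti_finite_ensemble.
by rewrite anti_mutual_info.
Qed.
End AntiEnsemble.

Theorem corollary9 (R : realType) (n : 'I_12 -> 'rV[R]_3)
    (hn : icosahedron_vertices n) :
  [/\ t_design_povm 5 (bloch_povm n),
      informational_power (bloch_povm n) =
        (ln 2 - 5 / 12 * ln 5
         - Num.sqrt 5 / 12 * ln ((9 - 3 * Num.sqrt 5) / 6))%:E,
      finite_ensemble (anti_ensemble n),
      (finite_mutual_info (anti_ensemble n) (bloch_povm n))%:E =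
        informational_power (bloch_povm n) &
      forall x : 'I_12, anti_ensemble n x *m bloch_povm n x = 0].
Proof.
rewrite icosahedral_power// anti_mutual_info// -max_infoE.
split=> //; first exact: icosahedral_t_design.
  exact: anti_finite_ensemble.
exact: anti_orthogonal.
Qed.
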